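(* Let $\mathbb G$ be a Carnot group of step 2 with Carnot–Carathéodory distance $d$, and let $d_0 := d(\cdot,0)$. Then $d_0^2$ is h-semiconcave in $\mathbb G$: there exists a constant $C\ge 0$ such that $$d_0^2(p\cdot h)+d_0^2(p\cdot h^{-1})-2d_0^2(p)\le C|h|^2\quad\text{for all } p\in\mathbb G,\ h\in\mathcal H_0.$$
   Context: A step 2 Carnot group $\mathbb G$ is a connected, simply connected Lie group whose Lie algebra splits as $\mathfrak g=\mathfrak g_1\oplus\mathfrak g_2$ with $[\mathfrak g_1,\mathfrak g_1]=\mathfrak g_2\neq\{0\}$ and $[\mathfrak g_1,\mathfrak g_2]=\{0\}$. Via exponential coordinates $\mathbb G$ is identified with $\mathbb R^n=\mathbb R^m\times\mathbb R^{n_2}$ ($m=\dim\mathfrak g_1$), writing $p=(p^{(1)},p^{(2)})$, with group law $p\cdot q=(p^{(1)}+q^{(1)},\,p^{(2)}+q^{(2)}+\mathcal B(p^{(1)},q^{(1)}))$ for a skew-symmetric bilinear map $\mathcal B:\mathbb R^m\times\mathbb R^m\to\mathbb R^{n_2}$; the identity is $0$ and $p^{-1}=-p$. Let $X_1,\dots,X_m$ be the left-invariant vector fields agreeing with $\partial/\partial p_i$ at $0$. A horizontal curve is an absolutely continuous $\gamma:[0,1]\to\mathbb G$ with $\dot\gamma(\tau)=\sum_{i=1}^m u_i(\tau)X_i(\gamma(\tau))$ a.e.; its length is $\int_0^1|u(\tau)|\,d\tau$. The Carnot–Carathéodory (CC) distance $d(p,q)$ is the infimum of lengths of horizontal curves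 from $p$ to $q$. The horizontal plane is $\mathcal H_0=\mathbb R^m\times\{0\}\subset\mathbb G$. $|\cdot|$ is the Euclidean norm on $\mathbb R^n$. For an open $\Omega\subset\mathbb G$, a lower semicontinuous $u:\Omega\to\mathbb R$ is h-semiconcave in $\Omega$ if there is $C\ge0$ with $u(p\cdot h)+u(p\cdot h^{-1})-2u(p)\le C|h|^2$ for all $p\in\Omega$, $h\in\mathcal H_0$ such that $\{p\cdot\tau h:\tau\in[-1,1]\}\subset\Omega$. *)

(* Defs.v *)
From HB Require Import structures.
From mathcomp Require Import all_boot all_order all_algebra.
From mathcomp Require Import all_classical all_reals all_analysis.
Set Implicit Arguments. Unset Strict Implicit. Unset Printing Implicit Defensive.
Import Order.TTheory GRing.Theory Num.Theory.
Local Open Scope classical_set_scope.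
Local Open Scope ring_scope.

Section Carnot.
Variables (R : realType) (m n2 : nat).

(* Points of G = R^m x R^{n2} in exponential coordinates: p = (p^(1), p^(2)). *)
Definition pt := ('rV[R]_m * 'rV[R]_n2)%type.

Definition enorm (k : nat) (v : 'rV[R]_k) : R := Num.sqrt (\sum_(i < k) v 0 i ^+ 2).
Definition enormG (p : pt) : R :=
  Num.sqrt (\sum_(i < m) p.1 0 i ^+ 2 + \sum_(j < n2) p.2 0 j ^+ 2).

(* B is a skew-symmetric bilinear map R^m x R^m -> R^{n2} whose image spans
   R^{n2} (i.e. [g1,g1] = g2) and n2 > 0 (i.e. g2 <> 0). *)
Definition step2_carnot_form (B : 'rV[R]_m -> 'rV[R]_m -> 'rV[R]_n2) : Prop :=
  [/\ (forall (a : R) x y z, B (a *: x + y) z = a *: B x z + B y z),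
      (forall x y, B x y = - B y x),
      (forall v : 'rV[R]_n2, exists k (c : 'I_k -> R) (x y : 'I_k -> 'rV[R]_m),
          v = \sum_(i < k) c i *: B (x i) (y i))
    & (0 < n2)%N].

Variable B : 'rV[R]_m -> 'rV[R]_m -> 'rV[R]_n2.

Definition gmul (p q : pt) : pt := (p.1 + q.1, p.2 + q.2 + B p.1 q.1).
Definition ginv (p : pt) : pt := (- p.1, - p.2).

(* gamma is horizontal on [0,1] with control u : the curve is absolutely
   continuous with gamma' = sum_i u_i X_i(gamma) a.e., where
   X_i(p) = (e_i, B(p^(1), e_i)); written in the equivalent integral form
   gamma(t) = gamma(0) + int_0^t (u, B(gamma^(1), u)), u in L^1(0,1). *)
Definition horizontal (gamma : R -> pt) (u : R -> 'rV[R]_m) : Prop :=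
  (forall i, (@lebesgue_measure R).-integrable `[0%R, 1%R] (fun s => (u s 0 i)%:E)) /\
  (forall j, (@lebesgue_measure R).-integrable `[0%R, 1%R]
                (fun s => (B (gamma s).1 (u s) 0 j)%:E)) /\
  (forall t, 0 <= t <= 1 ->
     (forall i, (gamma t).1 0 i =
        (gamma 0).1 0 i + Rintegral (@lebesgue_measure R) `[0%R, t] (fun s => u s 0 i)) /\
     (forall j, (gamma t).2 0 j =
        (gamma 0).2 0 j + Rintegral (@lebesgue_measure R) `[0%R, t]
                                     (fun s => B (gamma s).1 (u s) 0 j))).

Definition hlength (u : R -> 'rV[R]_m) : \bar R :=
  (\int[@lebesgue_measure R]_(s in `[0%R, 1%R]) (enorm (u s))%:E)%E.

Definition ccdistE (p q : pt) : \bar R :=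
  ereal_inf [set L | exists gamma u, [/\ horizontal gamma u, gamma 0 = p,
                                         gamma 1 = q & L = hlength u]].
Definition ccdist (p q : pt) : R := fine (ccdistE p q).

End Carnot.

(* Main.v *)
(** Sampling a horizontal curve at [N + 1] points equidistributed in arc length
    shows that [d0 p ^ 2] is the infimum of the energies
    [N * \sum_j |x_(j+1) - x_j|^2] of polygons [x] in R^m from [p^(1)] to [0] whose
    area [\sum_j B (x_j, x_(j+1))] is [- p^(2)].  Write [a_j] for the increments.

    Perturbing [x] by [v] changes the area by the linear term
    [\sum_j B (v_j + v_(j+1), a_j)] plus the area of [v].  A dimension count gives,
    for every polygon and every [q], a [v] with zero linear term, area [q] and
    energy at most [C |q|]; choosing between [v] and [- v], one corrects any area
    defect [q] at a cost [C |q|] in energy.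

    Hence for a near-minimizing polygon the first variation of the energy is
    dominated by that of the area, so that Lagrange multipliers exist and are
    bounded by a universal constant: the control solves, weakly, [u' = u A] with
    [A] in a fixed bounded set of matrices.  Integrating [psi = t^m (1-t)^(m+1) / m!]
    and its derivatives against [u] and using the Cayley-Hamilton theorem, the
    polynomial [phi = \sum_k (char_poly A)_k psi^(k)] satisfies [phi 0 = 1],
    [phi 1 = 0] and [\int phi u = 0], with bounded coefficients.

    The curves [x + phi h] and [x - phi h] then join [p h] and [p h^-1] to [0]: the
    linear term is [2 B (h, \int phi u) = 0] and the area of [phi h] vanishes because
    [B (h, h) = 0].  The first-order terms of their energies cancel in the sum. *)

Require Import Defs.
From HB Require Import structures.
From mathcomp Require Import all_boot all_order all_algebra.
From mathcomp Require Import all_classical all_reals all_analysis.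
From mathcomp Require Import measurable_realfun perm ring lra.
Import Order.TTheory GRing.Theory Num.Theory.
Import numFieldNormedType.Exports.
Local Open Scope ring_scope.
Set Implicit Arguments. Unset Strict Implicit. Unset Printing Implicit Defensive.

(** * The Euclidean norm and skew-symmetric bilinear maps *)

Section Euclid.
Variables (R : realType) (k : nat).
Implicit Types (u v w : 'rV[R]_k).

Definition dotv u v : R := \sum_i u 0 i * v 0 i.

Lemma dotvC u v : dotv u v = dotv v u.
Proof. by apply: eq_bigr => i _; rewrite mulrC. Qed.

Lemma dotvDl u v w : dotv (u + v) w = dotv u w + dotv v w.
Proof. by rewrite -big_split; apply: eq_bigr => i _; rewrite mxE mulrDl. Qed.

Lemma dotvZl a u v : dotv (a *: u) v = a * dotv u v.
Proof. by rewrite mulr_sumr; apply: eq_bigr => i _; rewrite mxE mulrA. Qed.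

Lemma dotvDr u v w : dotv w (u + v) = dotv w u + dotv w v.
Proof. by rewrite dotvC dotvDl !(dotvC w). Qed.

Lemma dotvZr a u v : dotv v (a *: u) = a * dotv v u.
Proof. by rewrite dotvC dotvZl dotvC. Qed.

Lemma dotvNl u v : dotv (- u) v = - dotv u v.
Proof. by rewrite -scaleN1r dotvZl mulN1r. Qed.

Lemma dotvNr u v : dotv u (- v) = - dotv u v.
Proof. by rewrite dotvC dotvNl dotvC. Qed.

Lemma dot0v u : dotv 0 u = 0.
Proof. by rewrite -(scale0r 0) dotvZl mul0r. Qed.

Lemma dotv_sumr (I : Type) (s : seq I) (P : pred I) (F : I -> 'rV[R]_k) u :
  dotv u (\sum_(i <- s | P i) F i) = \sum_(i <- s | P i) dotv u (F i).
Proof.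
apply: (big_morph (dotv u)) => [x y|]; first exact: dotvDr.
by rewrite dotvC dot0v.
Qed.

Lemma dotv_ge0 u : 0 <= dotv u u.
Proof. by apply: sumr_ge0 => i _; rewrite -expr2 sqr_ge0. Qed.

Lemma dotvv_eq0 u : dotv u u = 0 -> u = 0.
Proof.
move/eqP; rewrite psumr_eq0 => [/allP h|i _]; last by rewrite -expr2 sqr_ge0.
apply/rowP => i; apply/eqP; have := h i (mem_index_enum _).
by rewrite /= mulf_eq0 orbb mxE.
Qed.

Lemma enormE u : enorm u = Num.sqrt (dotv u u).
Proof. by congr Num.sqrt; apply: eq_bigr => i _; rewrite expr2. Qed.

Lemma enorm_ge0 u : 0 <= enorm u.
Proof. exact: sqrtr_ge0. Qed.

Lemma sqr_enorm u : enorm u ^+ 2 = dotv u u.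
Proof. by rewrite enormE sqr_sqrtr // dotv_ge0. Qed.

(** Cauchy-Schwarz, from expanding the squared norm of [enorm v *: u - enorm u *: v]. *)
Lemma ler_dotv u v : dotv u v <= enorm u * enorm v.
Proof.
have [u0|un0] := eqVneq (enorm u) 0.
  have -> : u = 0 by apply: dotvv_eq0; rewrite -sqr_enorm u0 expr0n.
  by rewrite dot0v mulr_ge0 // enorm_ge0.
have [v0|vn0] := eqVneq (enorm v) 0.
  have -> : v = 0 by apply: dotvv_eq0; rewrite -sqr_enorm v0 expr0n.
  by rewrite dotvC dot0v mulr_ge0 // enorm_ge0.
have : 0 < enorm u * enorm v by rewrite mulr_gt0 // lt_def enorm_ge0 ?un0 ?vn0.
have := dotv_ge0 (enorm v *: u - enorm u *: v).
rewrite dotvDl !dotvDr !dotvNl !dotvNr !dotvZl !dotvZr (dotvC v u) -!sqr_enorm.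
move: (enorm u) (enorm v) (dotv u v) => a b c h ab.
rewrite -(ler_pM2l ab); nra.
Qed.

Lemma ler_norm_dotv u v : `|dotv u v| <= enorm u * enorm v.
Proof.
rewrite ler_norml ler_dotv andbT lerNl -dotvNl.
by apply: le_trans (ler_dotv _ _) _; rewrite !enormE dotvNl dotvNr opprK.
Qed.

Lemma enormZ a u : enorm (a *: u) = `|a| * enorm u.
Proof.
by rewrite !enormE dotvZl dotvZr mulrA -expr2 sqrtrM ?sqr_ge0 // sqrtr_sqr.
Qed.

Lemma dotv_delta i u : dotv (delta_mx 0 i) u = u 0 i.
Proof.
rewrite /dotv (bigD1 i) //= big1 => [|j ji].
  by rewrite !mxE !eqxx mul1r addr0.
by rewrite !mxE (negbTE ji) andbF mul0r.
Qed.

Lemma enorm_delta i : enorm (delta_mx 0 i : 'rV[R]_k) = 1.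
Proof. by rewrite enormE dotv_delta mxE !eqxx sqrtr1. Qed.

Lemma enormN u : enorm (- u) = enorm u.
Proof. by rewrite -scaleN1r enormZ normrN1 mul1r. Qed.

Lemma enorm0 : enorm (0 : 'rV[R]_k) = 0.
Proof. by rewrite -(scale0r 0) enormZ normr0 mul0r. Qed.

Lemma ler_enormD u v : enorm (u + v) <= enorm u + enorm v.
Proof.
rewrite -ler_sqr ?nnegrE ?addr_ge0 ?enorm_ge0 // sqr_enorm dotvDl !dotvDr.
rewrite (dotvC v u) -!sqr_enorm; have := ler_dotv u v; nra.
Qed.

Lemma ler_enorm_sum (I : Type) (s : seq I) (P : pred I) (F : I -> 'rV[R]_k) :
  enorm (\sum_(i <- s | P i) F i) <= \sum_(i <- s | P i) enorm (F i).
Proof.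
elim/big_rec2: _ => [|i x y _ h]; first by rewrite enorm0.
by apply: le_trans (ler_enormD _ _) _; rewrite lerD2l.
Qed.

Lemma ler_coord_enorm u i : `|u 0 i| <= enorm u.
Proof.
rewrite -ler_sqr ?nnegrE ?enorm_ge0 ?normr_ge0 // real_normK ?num_real //.
rewrite sqr_enorm /dotv (bigD1 i) //= -expr2 lerDl.
by apply: sumr_ge0 => j _; rewrite -expr2 sqr_ge0.
Qed.

Definition norm1 u : R := \sum_i `|u 0 i|.

Lemma norm1_ge0 u : 0 <= norm1 u.
Proof. by apply: sumr_ge0. Qed.

Lemma norm10 : norm1 0 = 0.
Proof. by apply: big1 => i _; rewrite mxE normr0. Qed.

Lemma ler_norm1D u v : norm1 (u + v) <= norm1 u + norm1 v.
Proof. by rewrite -big_split; apply: ler_sum => i _; rewrite mxE ler_normD. Qed.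

Lemma norm1N u : norm1 (- u) = norm1 u.
Proof. by apply: eq_bigr => i _; rewrite mxE normrN. Qed.

Lemma norm1Z a u : norm1 (a *: u) = `|a| * norm1 u.
Proof. by rewrite mulr_sumr; apply: eq_bigr => i _; rewrite mxE normrM. Qed.

Lemma ler_norm1_sum (I : Type) (s : seq I) (P : pred I) (F : I -> 'rV[R]_k) :
  norm1 (\sum_(i <- s | P i) F i) <= \sum_(i <- s | P i) norm1 (F i).
Proof.
elim/big_rec2: _ => [|i x y _ h]; first by rewrite norm10.
by apply: le_trans (ler_norm1D _ _) _; rewrite lerD2l.
Qed.

Lemma ler_enorm_norm1 u : enorm u <= norm1 u.
Proof.
rewrite {1}(row_sum_delta u); apply: le_trans (ler_enorm_sum _ _ _) _.
by apply: ler_sum => i _; rewrite enormZ enorm_delta mulr1.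
Qed.

Lemma ler_norm1_enorm u : norm1 u <= k%:R * enorm u.
Proof.
rewrite mulr_natl -[X in _ *+ X]card_ord -sumr_const.
by apply: ler_sum => i _; exact: ler_coord_enorm.
Qed.

End Euclid.

(** Cauchy-Schwarz against the constant 1: in the double sum, [f s * f t] is at most the mean of
    [f s ^+ 2] and [f t ^+ 2]. *)
Lemma sqr_sum_le_fin (R : realType) (T : finType) (f : T -> R) :
  (\sum_t f t) ^+ 2 <= #|T|%:R * \sum_t f t ^+ 2.
Proof.
rewrite expr2 big_distrlr /=.
apply: le_trans (_ : \sum_s \sum_t (f s ^+ 2 + f t ^+ 2) / 2 <= _).
  apply: ler_sum => s _; apply: ler_sum => t _.
  have := sqr_ge0 (f s - f t); lra.
rewrite (eq_bigr (fun s => (#|T|%:R * f s ^+ 2 + \sum_t f t ^+ 2) / 2)) => [|s _].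
  rewrite -mulr_suml big_split /= -mulr_sumr sumr_const -[X in _ + X]mulr_natl.
  by rewrite le_eqVlt; apply/orP; left; apply/eqP; field.
by rewrite mulr_natl -mulr_suml big_split /= sumr_const.
Qed.

Lemma sqr_sum_le (R : realType) (n : nat) (f : nat -> R) :
  (\sum_(j < n) f j) ^+ 2 <= n%:R * \sum_(j < n) f j ^+ 2.
Proof. by have := sqr_sum_le_fin (fun j : 'I_n => f j); rewrite card_ord. Qed.

Section Bilinear.
Variables (R : realType) (m n2 : nat) (B : 'rV[R]_m -> 'rV[R]_m -> 'rV[R]_n2).
Hypothesis Blin : forall (a : R) x y z, B (a *: x + y) z = a *: B x z + B y z.
Hypothesis Bskew : forall x y, B x y = - B y x.

Lemma bil0l y : B 0 y = 0.
Proof.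
have := Blin 1 0 0 y; rewrite !scale1r addr0 => /(congr1 (fun z => z - B 0 y)).
by rewrite subrr addrK.
Qed.

Lemma bilDl x y z : B (x + y) z = B x z + B y z.
Proof. by rewrite -{1}(scale1r x) Blin scale1r. Qed.

Lemma bilZl a x z : B (a *: x) z = a *: B x z.
Proof. by rewrite -{1}(addr0 (a *: x)) Blin bil0l addr0. Qed.

Lemma bilNl x z : B (- x) z = - B x z.
Proof. by rewrite -scaleN1r bilZl scaleN1r. Qed.

Lemma bil0r y : B y 0 = 0. Proof. by rewrite Bskew bil0l oppr0. Qed.

Lemma bilDr x y z : B z (x + y) = B z x + B z y.
Proof. by rewrite Bskew bilDl opprD -!Bskew. Qed.

Lemma bilZr a x z : B z (a *: x) = a *: B z x.
Proof. by rewrite Bskew bilZl -scalerN -Bskew. Qed.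

Lemma bilNr x z : B z (- x) = - B z x.
Proof. by rewrite -scaleN1r bilZr scaleN1r. Qed.

Lemma bilxx x : B x x = 0.
Proof.
have /eqP := Bskew x x; rewrite -addr_eq0 -mulr2n -scaler_nat scaler_eq0.
by rewrite pnatr_eq0 /= => /eqP.
Qed.

Lemma bil_suml (I : Type) (s : seq I) (P : pred I) (F : I -> 'rV[R]_m) z :
  B (\sum_(i <- s | P i) F i) z = \sum_(i <- s | P i) B (F i) z.
Proof. exact: (big_morph (B^~ z) (fun x y => bilDl x y z) (bil0l z)). Qed.

Lemma bil_sumr (I : Type) (s : seq I) (P : pred I) (F : I -> 'rV[R]_m) z :
  B z (\sum_(i <- s | P i) F i) = \sum_(i <- s | P i) B z (F i).
Proof. exact: (big_morph (B z) (fun x y => bilDr x y z) (bil0r z)). Qed.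

Lemma bilE x y :
  B x y = \sum_i \sum_j (x 0 i * y 0 j) *: B (delta_mx 0 i) (delta_mx 0 j).
Proof.
rewrite {1}(row_sum_delta x) bil_suml; apply: eq_bigr => i _.
rewrite {1}(row_sum_delta y) bil_sumr; apply: eq_bigr => j _.
by rewrite bilZl bilZr scalerA.
Qed.

Lemma bil_bounded :
  exists2 b : R, 0 <= b & forall x y, norm1 (B x y) <= b * (enorm x * enorm y).
Proof.
exists (\sum_i \sum_j norm1 (B (delta_mx 0 i) (delta_mx 0 j))).
  by apply: sumr_ge0 => i _; apply: sumr_ge0 => j _; rewrite norm1_ge0.
move=> x y; rewrite bilE.
apply: le_trans (ler_norm1_sum _ _ _) _; rewrite mulr_suml.
apply: ler_sum => i _; apply: le_trans (ler_norm1_sum _ _ _) _.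
rewrite mulr_suml; apply: ler_sum => j _; rewrite norm1Z mulrC normrM.
by rewrite ler_wpM2l ?norm1_ge0 // ler_pM // ler_coord_enorm.
Qed.

End Bilinear.

(** * Polygons as horizontal curves *)

Section RealIntegrals.
Variables (d : measure_display) (T : measurableType d) (R : realType).
Variables (mu : {measure set T -> \bar R}) (D : set T) (mD : measurable D).
Notation integrableR f := (mu.-integrable D (EFin \o f)).
Implicit Types f g : T -> R.

Lemma integrableRD f g : integrableR f -> integrableR g ->
  integrableR (fun s => f s + g s).
Proof. by move=> hf hg; exact: (integrableD mD hf hg). Qed.

Lemma integrableRZ a f : integrableR f -> integrableR (fun s => a * f s).
Proof. by move=> hf; exact: (integrableZl mD a hf). Qed.

Lemma integrableR0 : integrableR (fun=> 0).
Proof. exact: integrable0. Qed.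

Lemma integrableR_sum (I : Type) (s : seq I) (h : I -> T -> R) :
  (forall i, integrableR (h i)) -> integrableR (fun x => \sum_(i <- s) h i x).
Proof.
move=> hh; elim: s => [|i s IH].
  by under eq_fun do rewrite big_nil; exact: integrableR0.
by under eq_fun do rewrite big_cons; exact: integrableRD.
Qed.

Lemma Rintegral_sum (I : Type) (s : seq I) (h : I -> T -> R) :
  (forall i, integrableR (h i)) ->
  Rintegral mu D (fun x => \sum_(i <- s) h i x) =
  \sum_(i <- s) Rintegral mu D (h i).
Proof.
move=> hh; elim: s => [|i s IH].
  by under eq_fun do rewrite big_nil; rewrite big_nil Rintegral_cst // mul0r.
under eq_fun do rewrite big_cons.
by rewrite big_cons RintegralD ?IH //; exact: integrableR_sum.
Qed.

Lemma EFin_Rintegral f : integrableR f ->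
  (Rintegral mu D f)%:E = (\int[mu]_(s in D) (f s)%:E)%E.
Proof. by move=> hf; rewrite fineK //; exact: integrable_fin_num. Qed.

End RealIntegrals.

(** * Integrals of step functions on a uniform partition *)

Section StepFunctions.
Local Open Scope classical_set_scope.
Variable R : realType.
Notation mu := (@lebesgue_measure R).

Definition ramp (a b t : R) : R := Num.max 0 (Num.min b t - a).

Lemma Rintegral_indic_itvco (a b t : R) : 0 <= a -> a <= b ->
  Rintegral mu `[0, t] (\1_(`[a, b[ : set R)) = ramp a b t.
Proof.
move=> a0 ab; rewrite /Rintegral integral_indic //=.
rewrite /ramp; case: (leP b t) => bt.
- have -> : (`[a, b[ `&` `[0, t] : set R) = `[a, b[.
    apply/seteqP; split=> x /=; rewrite !in_itv /=; first by case.
    by move=> /andP[ax xb]; rewrite ax xb; split=> //; lra.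
  rewrite lebesgue_measure_itv /= lte_fin; case: ltP => h.
    by rewrite /= max_r // subr_ge0.
  by rewrite max_l // subr_le0.
- have -> : (`[a, b[ `&` `[0, t] : set R) = `[a, t].
    apply/seteqP; split=> x /=; rewrite !in_itv /=.
      by move=> [/andP[-> xb] /andP[_ ->]].
    move=> /andP[ax xt]; rewrite ax xt; split=> //; first by lra.
    by rewrite (le_trans a0 ax).
  rewrite lebesgue_measure_itv /= lte_fin; case: ltP => h.
    by rewrite /= max_r // subr_ge0 ltW.
  by rewrite max_l // subr_le0.
Qed.

Variable N : nat.
Hypothesis N_gt0 : (0 < N)%N.

Definition cell (j : nat) : set R := `[j%:R / N%:R, j.+1%:R / N%:R[.
Definition cramp (j : nat) : R -> R := ramp (j%:R / N%:R) (j.+1%:R / N%:R).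
Definition stepf (c : nat -> R) (s : R) : R := \sum_(j < N) c j * \1_(cell j) s.

Lemma integrable_cell j (t : R) : mu.-integrable `[0, t] (EFin \o \1_(cell j)).
Proof.
by apply: (@integrableS _ _ _ mu setT) => //; exact: integrable_indic_itv.
Qed.

Lemma integrable_step (c : nat -> R) (t : R) :
  mu.-integrable `[0, t] (EFin \o stepf c).
Proof.
by apply: integrableR_sum => // j; apply: integrableRZ => //; exact: integrable_cell.
Qed.

Lemma Rintegral_step (c : nat -> R) (t : R) :
  Rintegral mu `[0, t] (stepf c) = \sum_(j < N) c j * cramp j t.
Proof.
rewrite Rintegral_sum // => [|j].
  apply: eq_bigr => j _; rewrite RintegralZl //; last exact: integrable_cell.
  rewrite Rintegral_indic_itvco // ?divr_ge0 //.
  by rewrite ler_wpM2r ?invr_ge0 // ler_nat.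
by apply: integrableRZ => //; exact: integrable_cell.
Qed.

Let Nr0 : 0 < N%:R :> R. Proof. by rewrite ltr0n. Qed.

Lemma le_cell (i j : nat) : (i <= j)%N -> i%:R / N%:R <= j%:R / N%:R :> R.
Proof. by move=> ij; rewrite ler_wpM2r ?invr_ge0 // ler_nat. Qed.

Lemma cramp_right (j : nat) (t : R) : j.+1%:R / N%:R <= t -> cramp j t = N%:R^-1.
Proof.
move=> h; rewrite /cramp /ramp min_l // -mulrBl -natr1 addrAC subrr add0r mul1r.
by rewrite max_r // invr_ge0.
Qed.

Lemma cramp_left (j : nat) (t : R) : t <= j%:R / N%:R -> cramp j t = 0.
Proof.
by move=> h; rewrite /cramp /ramp max_l // subr_le0 ge_min h orbT.
Qed.

Lemma cramp0 j : cramp j 0 = 0.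
Proof. by apply: cramp_left; rewrite divr_ge0. Qed.

Lemma cramp1 (j : 'I_N) : cramp j 1 = N%:R^-1.
Proof.
apply: cramp_right; rewrite ler_pdivrMr // mul1r ler_nat; exact: ltn_ord.
Qed.

End StepFunctions.

Section PolygonalCurve.
Local Open Scope classical_set_scope.
Variables (R : realType) (m n2 : nat) (B : 'rV[R]_m -> 'rV[R]_m -> 'rV[R]_n2).
Hypothesis Blin : forall (a : R) x y z, B (a *: x + y) z = a *: B x z + B y z.
Hypothesis Bskew : forall x y, B x y = - B y x.
Notation mu := (@lebesgue_measure R).

(* Skew-symmetry of [B] gives [B (x j) (x j.+1) = B (x j) (x j.+1 - x j)]. *)
Definition area (N : nat) (x : nat -> 'rV[R]_m) : 'rV[R]_n2 :=
  \sum_(j < N) B (x j) (x j.+1).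

Definition energy (N : nat) (x : nat -> 'rV[R]_m) : R :=
  N%:R * \sum_(j < N) enorm (x j.+1 - x j) ^+ 2.

Variables (N : nat) (N_gt0 : (0 < N)%N) (x : nat -> 'rV[R]_m) (q : 'rV[R]_n2).
Let Nr0 : N%:R != 0 :> R. Proof. by rewrite pnatr_eq0 -lt0n. Qed.

Definition polyu (s : R) : 'rV[R]_m :=
  \sum_(j < N) (N%:R * \1_(cell N j) s) *: (x j.+1 - x j).

(** The vertical part is piecewise linear too: on cell [j] skew-symmetry reduces [B (gamma^(1), u)]
    to the constant [N B (x_j, x_(j+1))]. *)
Definition polyc (s : R) : pt R m n2 :=
  (x 0 + \sum_(j < N) (N%:R * cramp N j s) *: (x j.+1 - x j),
   q + \sum_(j < N) (N%:R * cramp N j s) *: B (x j) (x j.+1)).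

Lemma sum_increments (V : zmodType) (y : nat -> V) n :
  \sum_(j < n) (y j.+1 - y j) = y n - y 0.
Proof.
by rewrite -(big_mkord xpredT (fun j => y j.+1 - y j)) telescope_sumr.
Qed.

(** On cell [j] the earlier ramps have reached [1 / N] and the later ones are still 0, so the sum
    telescopes up to one partial increment. *)
Lemma polyc_cell (j : 'I_N) (s : R) : cell N j s ->
  (polyc s).1 = x j + (N%:R * cramp N j s) *: (x j.+1 - x j).
Proof.
rewrite /cell /= in_itv /= => /andP[js sj].
rewrite /= (bigID (fun i : 'I_N => (i < j)%N)) /= addrA.
rewrite [X in _ + X = _](bigD1 j) ?ltnn //= [X in _ + (_ + X)]big1 => [|i /andP[ij ni]]; last first.
  rewrite cramp_left ?mulr0 ?scale0r //; apply: le_trans (ltW sj) _.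
  by apply: le_cell => //; rewrite ltn_neqAle eq_sym ni leqNgt ij.
rewrite addr0; congr (_ + _).
rewrite (eq_bigr (fun i : 'I_N => x i.+1 - x i)) => [|i ij]; last first.
  rewrite cramp_right ?divff ?scale1r //; apply: le_trans _ js.
  exact: le_cell.
rewrite -(big_ord_widen N (fun i => x i.+1 - x i) (ltnW (ltn_ord j))).
by rewrite sum_increments addrC subrK.
Qed.

Lemma bil_polyc (s : R) :
  B (polyc s).1 (polyu s) =
  \sum_(j < N) (N%:R * \1_(cell N j) s) *: B (x j) (x j.+1).
Proof.
rewrite /polyu (bil_sumr Blin Bskew); apply: eq_bigr => j _.
rewrite (bilZr Blin Bskew) indicE; have [|] := boolP (s \in cell N j); last first.
  by rewrite mulr0 !scale0r.
rewrite inE => /polyc_cell ->; congr (_ *: _).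
rewrite (bilDl Blin) (bilZl Blin) (bilxx Bskew) scaler0 addr0.
by rewrite (bilDr Blin Bskew) (bilNr Blin Bskew) (bilxx Bskew) subr0.
Qed.

Lemma coord_step (k : nat) (c : nat -> 'rV[R]_k) i (s : R) :
  (\sum_(j < N) (N%:R * \1_(cell N j) s) *: c j) 0 i =
  stepf N (fun j => N%:R * c j 0 i) s.
Proof.
by rewrite summxE; apply: eq_bigr => j _; rewrite mxE mulrAC.
Qed.

Lemma coord_polyu (s : R) i :
  polyu s 0 i = stepf N (fun j => N%:R * (x j.+1 - x j) 0 i) s.
Proof. exact: (coord_step (fun j => x j.+1 - x j)). Qed.

Lemma coord_bil_polyc (s : R) i :
  B (polyc s).1 (polyu s) 0 i = stepf N (fun j => N%:R * B (x j) (x j.+1) 0 i) s.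
Proof. by rewrite bil_polyc; exact: (coord_step (fun j => B (x j) (x j.+1))). Qed.

Lemma horizontal_polyc : horizontal B polyc polyu.
Proof.
split=> [i|].
  by apply: eq_integrable (integrable_step N _ 1) => // s _; rewrite /= coord_polyu.
split=> [i|].
  by apply: eq_integrable (integrable_step N _ 1) => // s _; rewrite /= coord_bil_polyc.
have coordR (k : nat) (y : 'rV[R]_k) (c : nat -> 'rV[R]_k) i (t : R) :
    (y + \sum_(j < N) (N%:R * cramp N j t) *: c j) 0 i =
    (y + \sum_(j < N) (N%:R * cramp N j 0) *: c j) 0 i +
    Rintegral mu `[0, t] (stepf N (fun j => N%:R * c j 0 i)).
  rewrite Rintegral_step // !mxE -addrA; congr (_ + _).
  rewrite [X in fun_of_matrix X 0 i + _]big1 => [|j _]; last by rewrite cramp0 mulr0 scale0r.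
  rewrite mxE add0r summxE; apply: eq_bigr => j _.
  by rewrite mxE mulrAC.
move=> t t01; split=> i /=.
  rewrite (coordR _ _ (fun j => x j.+1 - x j)); congr (_ + _).
  by apply: eq_Rintegral => s _; rewrite coord_polyu.
rewrite (coordR _ _ (fun j => B (x j) (x j.+1))); congr (_ + _).
by apply: eq_Rintegral => s _; rewrite coord_bil_polyc.
Qed.

Lemma polyc0 : polyc 0 = (x 0, q).
Proof.
by congr (_, _); rewrite big1 ?addr0 // => j _; rewrite cramp0 mulr0 scale0r.
Qed.

Lemma polyc1 : polyc 1 = (x N, q + area N x).
Proof.
rewrite /polyc; congr (_, _); last congr (_ + _).
  under eq_bigr do rewrite cramp1 // divff // scale1r.
  by rewrite sum_increments addrC subrK.
by apply: eq_bigr => j _; rewrite cramp1 // divff // scale1r.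
Qed.

Lemma enorm_polyu (s : R) :
  enorm (polyu s) <= stepf N (fun j => N%:R * enorm (x j.+1 - x j)) s.
Proof.
apply: le_trans (ler_enorm_sum _ _ _) _; apply: ler_sum => j _.
by rewrite enormZ ger0_norm 1?mulrAC // mulr_ge0 // indicE.
Qed.

(** The triangle inequality inside [polyu] bounds the speed by a scalar step function with explicit
    integral; an upper bound is enough for estimating an infimum. *)
Lemma hlength_polyu :
  (hlength polyu <= (\sum_(j < N) enorm (x j.+1 - x j))%:E)%E.
Proof.
have -> : \sum_(j < N) enorm (x j.+1 - x j) =
          Rintegral mu `[0, 1] (stepf N (fun j => N%:R * enorm (x j.+1 - x j))).
  rewrite Rintegral_step //; apply: eq_bigr => j _.
  by rewrite cramp1 // mulrAC divff // mul1r.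
rewrite EFin_Rintegral //; last exact: integrable_step.
apply: ge0_le_integral => //.
- by move=> s _; rewrite lee_fin enorm_ge0.
- apply/measurable_EFinP; apply: measurableT_comp.
    by apply: continuous_measurable_fun; exact: sqrt_continuous.
  apply: measurable_sum => i; apply: measurable_funX.
  have /integrableP[/measurable_EFinP h _] :=
    integrable_step N (fun j => N%:R * (x j.+1 - x j) 0 i) 1.
  by apply: eq_measurable_fun h => s _; rewrite coord_polyu.
- by have /integrableP[] := integrable_step N (fun j => N%:R * enorm (x j.+1 - x j)) 1.
- by move=> s _; rewrite lee_fin enorm_polyu.
Qed.

End PolygonalCurve.

(** * Polygons bound the distance from above *)

Section DistanceUpperBound.
Variables (R : realType) (m n2 : nat) (B : 'rV[R]_m -> 'rV[R]_m -> 'rV[R]_n2).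
Hypothesis Blin : forall (a : R) x y z, B (a *: x + y) z = a *: B x z + B y z.
Hypothesis Bskew : forall x y, B x y = - B y x.

Lemma hlength_ge0 (u : R -> 'rV[R]_m) : (0 <= hlength u)%E.
Proof. by apply: integral_ge0 => s _; rewrite lee_fin enorm_ge0. Qed.

Lemma ccdistE_ge0 p q : (0 <= ccdistE B p q)%E.
Proof.
by apply: le_ereal_inf_tmp => _ [gamma [u [_ _ _ ->]]]; exact: hlength_ge0.
Qed.

Lemma ccdist_ge0 p q : 0 <= ccdist B p q.
Proof. by rewrite fine_ge0 // ccdistE_ge0. Qed.

Section Polygon.
Variables (N : nat) (N_gt0 : (0 < N)%N) (x : nat -> 'rV[R]_m) (p : pt R m n2).
Hypotheses (x0 : x 0 = p.1) (xN : x N = 0) (pA : p.2 + area B N x = 0).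

Lemma ccdistE_polygon :
  (ccdistE B p (0%R, 0%R) <= (\sum_(j < N) enorm (x j.+1 - x j))%:E)%E.
Proof.
apply: le_trans (hlength_polyu N_gt0 x); apply: ereal_inf_lbound.
exists (polyc B N x p.2), (polyu N x); split=> //.
- exact: horizontal_polyc.
- by rewrite polyc0 // x0; case: (p).
- by rewrite polyc1 // xN pA.
Qed.

Lemma ccdistE_lty : (ccdistE B p (0%R, 0%R) < +oo)%E.
Proof. by apply: le_lt_trans ccdistE_polygon _; rewrite ltry. Qed.

(** By Cauchy-Schwarz the squared length of a polygon is at most its energy; the polygon also shows
    that [ccdistE] is finite, so [fine] loses nothing. *)
Lemma sqr_ccdist_polygon : ccdist B p (0, 0) ^+ 2 <= energy N x.
Proof.
apply: le_trans (sqr_sum_le N (fun j => enorm (x j.+1 - x j))).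
rewrite ler_sqr ?nnegrE ?ccdist_ge0 ?sumr_ge0 // => [|j _]; last exact: enorm_ge0.
rewrite -lee_fin fineK; first exact: ccdistE_polygon.
by rewrite ge0_fin_numE ?ccdistE_ge0 // ccdistE_lty.
Qed.

End Polygon.
End DistanceUpperBound.

(** * Polygonal approximation of horizontal curves *)

Section PolygonalApproximation.
Local Open Scope classical_set_scope.
Variables (R : realType) (m n2 : nat) (B : 'rV[R]_m -> 'rV[R]_m -> 'rV[R]_n2).
Hypothesis Blin : forall (a : R) x y z, B (a *: x + y) z = a *: B x z + B y z.
Hypothesis Bskew : forall x y, B x y = - B y x.
Variable b : R.
Hypothesis b_ge0 : 0 <= b.
Hypothesis bP : forall x y, norm1 (B x y) <= b * (enorm x * enorm y).
Notation mu := (@lebesgue_measure R).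
Variables (gamma : R -> pt R m n2) (u : R -> 'rV[R]_m) (eta : R).
Hypothesis hor : horizontal B gamma u.
Hypothesis eta_gt0 : 0 < eta.

Let uint i : mu.-integrable `[0, 1] (EFin \o (fun s => u s 0 i)).
Proof. by case: hor => + _; exact. Qed.

Let buint k : mu.-integrable `[0, 1] (EFin \o (fun s => B (gamma s).1 (u s) 0 k)).
Proof. by case: hor => _ [+ _]; exact. Qed.

Lemma integrable_enorm : mu.-integrable `[0, 1] (EFin \o (fun s => enorm (u s))).
Proof.
apply: (@le_integrable _ _ _ mu _ _ _ (EFin \o (fun s => \sum_i `|u s 0 i|))) => //.
- apply/measurable_EFinP; apply: measurableT_comp.
    by apply: continuous_measurable_fun; exact: sqrt_continuous.
  apply: measurable_sum => i; apply: measurable_funX.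
  by have /integrableP[/measurable_EFinP h _] := uint i.
- move=> s _; rewrite /= lee_fin ger0_norm ?enorm_ge0 // ger0_norm.
    exact: ler_enorm_norm1.
  exact: norm1_ge0.
- apply: integrableR_sum => // i; exact: (integrable_norm (uint i)).
Qed.

(* The summand [eta] makes [arclen] strictly increasing. *)
Definition speed (s : R) : R := enorm (u s) + eta.
Definition arclen (t : R) : R := Rintegral mu `[0, t] speed.

Let cst_int t : mu.-integrable `[0, t] (EFin \o cst eta).
Proof.
apply: measurable_bounded_integrable => //; last exact: bounded_cst.
by rewrite /= lebesgue_measure_itv /=; case: ifP => _; rewrite -?EFinB ltry.
Qed.

Lemma integrable_speed : mu.-integrable `[0, 1] (EFin \o speed).
Proof. by apply: integrableRD => //; exact: integrable_enorm. Qed.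

Section Segment.
Variables s t : R.
Hypotheses (s_ge0 : 0 <= s) (st : s <= t) (t_le1 : t <= 1).

Let sub_seg : `]s, t] `<=` `[0, 1].
Proof.
by move=> r /=; rewrite !in_itv /= => /andP[h1 h2]; rewrite (le_trans s_ge0 (ltW h1)) (le_trans h2).
Qed.

Let integrable_seg (f : R -> R) : mu.-integrable `[0, 1] (EFin \o f) ->
  mu.-integrable `]s, t] (EFin \o f).
Proof. exact: integrableS. Qed.

Lemma Rintegral_seg (f : R -> R) : mu.-integrable `[0, 1] (EFin \o f) ->
  Rintegral mu `]s, t] f = Rintegral mu `[0, t] f - Rintegral mu `[0, s] f.
Proof.
move=> fi; rewrite Rintegral_itvB ?bnd_simp //.
by apply: integrableS fi => //; apply: subset_itvl; rewrite bnd_simp.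
Qed.

(** Here [speed] is at least [eta]. Besides monotonicity this gives injectivity of [arclen], which
    places the extreme sampling nodes at 0 and 1. *)
Lemma arclenB_ge : eta * (t - s) <= arclen t - arclen s.
Proof.
rewrite -Rintegral_seg; last exact: integrable_speed.
have -> : eta * (t - s) = Rintegral mu `]s, t] (cst eta).
  rewrite Rintegral_cst //= lebesgue_measure_itv /= lte_fin; case: ltgtP st => //= st' _.
  by rewrite st' subrr.
apply: le_Rintegral => //.
- by apply: integrableS (cst_int 1).
- exact: (integrable_seg integrable_speed).
- by move=> r _; rewrite /speed lerDr enorm_ge0.
Qed.

Lemma arclen_le : arclen s <= arclen t.
Proof.
by rewrite -subr_ge0; apply: le_trans arclenB_ge; rewrite mulr_ge0 ?(ltW eta_gt0) ?subr_ge0.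
Qed.

Let s01 : 0 <= s <= 1. Proof. by rewrite s_ge0 (le_trans st). Qed.
Let t01 : 0 <= t <= 1. Proof. by rewrite t_le1 (le_trans s_ge0). Qed.

Lemma coord1_seg i :
  ((gamma t).1 - (gamma s).1) 0 i = Rintegral mu `]s, t] (fun r => u r 0 i).
Proof.
rewrite Rintegral_seg // !mxE; case: hor => _ [_ h].
have [-> _] := h t t01; have [-> _] := h s s01.
ring.
Qed.

Lemma coord2_seg k : ((gamma t).2 - (gamma s).2) 0 k =
  Rintegral mu `]s, t] (fun r => B (gamma r).1 (u r) 0 k).
Proof.
rewrite Rintegral_seg // !mxE; case: hor => _ [_ h].
have [_ ->] := h t t01; have [_ ->] := h s s01.
ring.
Qed.

(** Pairing the chord [v] with itself writes [enorm v ^+ 2] as the integral of the scalar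
    [dotv v u], to which Cauchy-Schwarz applies pointwise. *)
Lemma enorm_seg : enorm ((gamma t).1 - (gamma s).1) <= arclen t - arclen s.
Proof.
set v := _ - _.
have d0 : 0 <= arclen t - arclen s by rewrite subr_ge0 arclen_le.
have [->//|v0] := eqVneq (enorm v) 0.
have vp : 0 < enorm v by rewrite lt_def v0 enorm_ge0.
rewrite -(ler_pM2l vp) -expr2 sqr_enorm -Rintegral_seg; last exact: integrable_speed.
have -> : dotv v v = \sum_i v 0 i * Rintegral mu `]s, t] (fun r => u r 0 i).
  by apply: eq_bigr => i _; congr (_ * _); exact: coord1_seg.
have iv i : mu.-integrable `]s, t] (EFin \o (fun r => v 0 i * u r 0 i)).
  by apply: integrableRZ => //; exact: integrable_seg.
rewrite (eq_bigr (fun i => Rintegral mu `]s, t] (fun r => v 0 i * u r 0 i))); last first.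
  by move=> i _; rewrite RintegralZl //; exact: integrable_seg.
rewrite -Rintegral_sum // -RintegralZl //; last exact: (integrable_seg integrable_speed).
apply: le_Rintegral => //.
- exact: integrableR_sum.
- by apply: integrableRZ => //; exact: (integrable_seg integrable_speed).
- move=> r _; apply: le_trans (ler_dotv v (u r)) _.
  by rewrite ler_wpM2l ?enorm_ge0 // /speed lerDl ltW.
Qed.

End Segment.

(** The difference is the integral of [B (gamma^(1) r - gamma^(1) s) (u r)] over the segment. Its
    first argument is at most the arc length of the segment, and so is the integral of the second,
    hence a quadratic error; [n2] counts coordinates. *)
Lemma area_seg s t : 0 <= s -> s <= t -> t <= 1 ->
  norm1 ((gamma t).2 - (gamma s).2 - B (gamma s).1 (gamma t).1) <=
  n2%:R * (b * (arclen t - arclen s) ^+ 2).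
Proof.
move=> s0 st t1; rewrite mulr_natl -[n2 in X in _ <= X]card_ord -sumr_const.
set dL := arclen t - arclen s.
have dL0 : 0 <= dL by rewrite subr_ge0 arclen_le.
have sub_seg : `]s, t] `<=` (`[0, 1] : set R).
  by move=> r /=; rewrite !in_itv /= => /andP[h1 h2]; rewrite (le_trans s0 (ltW h1)) (le_trans h2).
apply: ler_sum => k _.
have -> : B (gamma s).1 (gamma t).1 = B (gamma s).1 ((gamma t).1 - (gamma s).1).
  by rewrite (bilDr Blin Bskew) (bilNr Blin Bskew) (bilxx Bskew) subr0.
have BE y (w : 'rV[R]_m) : B y w 0 k = \sum_i B y (delta_mx 0 i) 0 k * w 0 i.
  rewrite {1}(row_sum_delta w) (bil_sumr Blin Bskew) summxE; apply: eq_bigr => i _.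
  by rewrite (bilZr Blin Bskew) mxE mulrC.
have iB i : mu.-integrable `]s, t] (EFin \o
    (fun r => B (gamma s).1 (delta_mx 0 i) 0 k * u r 0 i)).
  by apply: integrableRZ => //; exact: integrableS (uint i).
have Eseg : B (gamma s).1 ((gamma t).1 - (gamma s).1) 0 k =
    Rintegral mu `]s, t] (fun r => B (gamma s).1 (u r) 0 k).
  rewrite BE; under eq_Rintegral do rewrite BE.
  rewrite Rintegral_sum //; apply: eq_bigr => i _.
  by rewrite coord1_seg // RintegralZl //; exact: integrableS (uint i).
have ig : mu.-integrable `]s, t] (EFin \o (fun r => B (gamma s).1 (u r) 0 k)).
  apply: (@eq_integrable _ _ _ mu _ _
    (EFin \o (fun r => \sum_i B (gamma s).1 (delta_mx 0 i) 0 k * u r 0 i))) => //.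
    by move=> r _; rewrite /= BE.
  exact: integrableR_sum.
have ih : mu.-integrable `]s, t] (EFin \o (fun r => B (gamma r).1 (u r) 0 k)).
  exact: integrableS (buint k).
rewrite mxE [X in _ + X]mxE coord2_seg // Eseg -RintegralB //.
apply: le_trans (le_normr_Rintegral _ _) _ => //.
  exact: (integrableB _ ih ig).
have -> : b * dL ^+ 2 = Rintegral mu `]s, t] (fun r => (b * dL) * speed r).
  rewrite RintegralZl //; last exact: integrableS integrable_speed.
  by rewrite Rintegral_seg //; [rewrite expr2 mulrA | exact: integrable_speed].
apply: le_Rintegral => //.
- by have := integrable_abse (integrableB _ ih ig); exact.
- by apply: integrableRZ => //; exact: integrableS integrable_speed.
move=> r /=; rewrite in_itv /= => /andP[sr rt].
rewrite -[X in `|X|](_ : B ((gamma r).1 - (gamma s).1) (u r) 0 k = _); last first.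
  by rewrite (bilDl Blin) (bilNl Blin) !mxE.
apply: le_trans (_ : norm1 (B ((gamma r).1 - (gamma s).1) (u r)) <= _).
  by rewrite /norm1 (bigD1 k) //= lerDl sumr_ge0.
apply: le_trans (bP _ _) _; rewrite -mulrA ler_wpM2l //.
apply: ler_pM; rewrite ?enorm_ge0 //; last by rewrite /speed lerDl ltW.
apply: le_trans (enorm_seg s0 (ltW sr) (le_trans rt t1)) _.
by rewrite lerD2r; apply: arclen_le => //; lra.
Qed.

(** Each of the [N] pieces has arc length [arclen 1 / N], so the quadratic errors of [area_seg] add
    up to order [1 / N]. *)
Lemma exists_polygon N : (0 < N)%N -> exists x : nat -> 'rV[R]_m,
  [/\ x 0%N = (gamma 0).1, x N = (gamma 1).1,
      energy N x <= arclen 1 ^+ 2 &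
      norm1 ((gamma 1).2 - (gamma 0).2 - area B N x) <=
      n2%:R * (b * arclen 1 ^+ 2) / N%:R].
Proof.
move=> N0; have Nr0 : 0 < N%:R :> R by rewrite ltr0n.
have arc0 : arclen 0 = 0 by rewrite /arclen set_itv1 Rintegral_set1.
have arc1_ge : eta <= arclen 1.
  have := @arclenB_ge 0 1 (lexx 0) ler01 (lexx 1).
  by rewrite arc0 !subr0 mulr1.
have arc1 : 0 < arclen 1 by apply: lt_le_trans arc1_ge.
(* The nodes come from the intermediate value theorem; beyond [N] the value 0 is a dummy. *)
have /choice[t tP] : forall j : nat, exists t, (j <= N)%N ->
    0 <= t <= 1 /\ arclen t = j%:R / N%:R * arclen 1.
  move=> j; have [jN|jN] := leqP j N; last by exists 0.
  have cont : {within `[0, 1], continuous arclen}.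
    exact: parameterized_integral_continuous ler01 integrable_speed.
  have jN1 : j%:R / N%:R <= 1 :> R by rewrite ler_pdivrMr // mul1r ler_nat.
  have [|c c01 Fc] := @IVT R arclen 0 1 (j%:R / N%:R * arclen 1) ler01 cont.
    rewrite arc0 (min_l (ltW arc1)) (max_r (ltW arc1)); apply/andP; split.
      by rewrite mulr_ge0 ?(ltW arc1) ?divr_ge0.
    by rewrite ler_piMl // ltW.
  by exists c => _; rewrite -Fc; split=> //; move: c01; rewrite in_itv.
have arct j : (j <= N)%N -> arclen (t j) = j%:R / N%:R * arclen 1 by case/tP.
have arc_inj r s : 0 <= r <= 1 -> 0 <= s <= 1 -> arclen r < arclen s -> r <= s.
  move=> r01 s01; rewrite leNgt; apply: contraTN => sr; rewrite -leNgt.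
  apply: arclen_le; lra.
have t_mono j : (j < N)%N -> t j <= t j.+1.
  move=> jN; have [h1 e1] := tP j (ltnW jN); have [h2 e2] := tP j.+1 jN.
  apply: arc_inj => //; rewrite e1 e2 ltr_pM2r // ltr_pM2r ?invr_gt0 //.
  by rewrite ltr_nat.
have t0 : t 0%N = 0.
  have [h e] := tP 0%N isT; have := @arclenB_ge 0 (t 0%N) (lexx _).
  rewrite e arc0 mulr0n !mul0r !subr0 pmulr_rle0 // => h2.
  by case/andP: h => h3 h4; apply/eqP; rewrite eq_le h2.
have tN : t N = 1.
  have [/andP[h3 h4] e] := tP N (leqnn _); have := @arclenB_ge (t N) 1 h3 h4 (lexx _).
  rewrite e divff ?gt_eqF // mul1r subrr pmulr_rle0 // subr_le0 => h5.
  by apply/eqP; rewrite eq_le h4 h5.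
have t01 j : (j <= N)%N -> 0 <= t j /\ t j <= 1 by case/tP => /andP.
have dt j : (j < N)%N -> arclen (t j.+1) - arclen (t j) = arclen 1 / N%:R.
  move=> jN; rewrite !arct ?(ltnW jN) // -!mulrBl -natr1 addrAC subrr add0r.
  by rewrite mul1r mulrC.
exists (fun j => (gamma (t j)).1); split; rewrite ?t0 ?tN //.
- rewrite /energy.
  apply: le_trans (_ : N%:R * \sum_(j < N) (arclen 1 / N%:R) ^+ 2 <= _).
    rewrite ler_wpM2l //; apply: ler_sum => j _.
    rewrite ler_sqr ?nnegrE ?enorm_ge0 ?divr_ge0 ?(ltW arc1) // -(dt j) //.
    have [a1 a2] := t01 j (ltnW (ltn_ord j)); have [a3 a4] := t01 j.+1 (ltn_ord j).
    by apply: enorm_seg => //; exact: t_mono.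
  rewrite sumr_const card_ord -mulr_natl le_eqVlt; apply/orP; left; apply/eqP.
  by field; rewrite gt_eqF.
- have -> : (gamma 1).2 - (gamma 0).2 =
      \sum_(j < N) ((gamma (t j.+1)).2 - (gamma (t j)).2).
    by rewrite (sum_increments (fun j => (gamma (t j)).2)) tN t0.
  rewrite /area -sumrB; apply: le_trans (ler_norm1_sum _ _ _) _.
  apply: le_trans (_ : \sum_(j < N) n2%:R * (b * (arclen 1 / N%:R) ^+ 2) <= _).
    apply: ler_sum => j _; rewrite -(dt j) //.
    have [a1 a2] := t01 j (ltnW (ltn_ord j)); have [a3 a4] := t01 j.+1 (ltn_ord j).
    by apply: area_seg => //; exact: t_mono.
  rewrite sumr_const card_ord -mulr_natl le_eqVlt; apply/orP; left; apply/eqP.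
  by field; rewrite gt_eqF.
Qed.

End PolygonalApproximation.

(** Sampling one almost shortest curve gives a [K] that may depend on [p] and [eps] but not on [N],
    so [N] can be taken large afterwards. *)
Lemma ccdist_polygon_approx (R : realType) (m n2 : nat)
    (B : 'rV[R]_m -> 'rV[R]_m -> 'rV[R]_n2) (p : pt R m n2) (eps : R) :
  (forall (a : R) x y z, B (a *: x + y) z = a *: B x z + B y z) ->
  (forall x y, B x y = - B y x) ->
  (ccdistE B p (0%R, 0%R) < +oo)%E -> 0 < eps ->
  exists2 K : R, 0 <= K & forall N, (0 < N)%N -> exists x : nat -> 'rV[R]_m,
    [/\ x 0%N = p.1, x N = 0, energy N x <= ccdist B p (0, 0) ^+ 2 + eps &
        norm1 (p.2 + area B N x) <= K / N%:R].
Proof.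
move=> Blin Bskew finE eps0; have [b b0 bP] := bil_bounded Blin Bskew.
set D := ccdist B p (0, 0); have D0 : 0 <= D by exact: ccdist_ge0.
(* The arc length will be at most [D + 2 * eta]; as [eta <= 1], its square exceeds [D ^+ 2] by at
   most [eta * (4 * D + 4) <= eps]. *)
pose eta : R := Num.min 1 (eps / (4 * D + 4)).
have den0 : 0 < 4 * D + 4 by lra.
have eta0 : 0 < eta by rewrite lt_min ltr01 divr_gt0.
have eta1 : eta <= 1 by rewrite ge_min lexx.
have eta2 : eta * (4 * D + 4) <= eps by rewrite -ler_pdivlMr // ge_min lexx orbT.
have : (ccdistE B p (0%R, 0%R) < (D + eta)%:E)%E.
  have /fineK <- : ccdistE B p (0%R, 0%R) \is a fin_num.
    by rewrite ge0_fin_numE ?ccdistE_ge0.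
  by rewrite lte_fin ltrDl.
move/ereal_inf_lt => [_ [gamma [u [hor g0 g1 ->]]]] len.
have len1 : arclen u eta 1 <= D + 2 * eta.
  rewrite /arclen RintegralD //=; last 2 first.
  - exact: integrable_enorm hor.
  - apply: measurable_bounded_integrable => //; last exact: bounded_cst.
    by rewrite /= lebesgue_measure_itv /= lte01 -EFinB ltry.
  rewrite Rintegral_cst //= lebesgue_measure_itv /= lte01 /= subr0 mulr1.
  have : Rintegral lebesgue_measure `[0, 1]%classic (fun s => enorm (u s)) < D + eta.
    by rewrite -lte_fin EFin_Rintegral //; exact: integrable_enorm hor.
  lra.
have len0 : 0 <= arclen u eta 1.
  by apply: Rintegral_ge0 => s _; rewrite addr_ge0 ?enorm_ge0 // ltW.
exists (n2%:R * (b * arclen u eta 1 ^+ 2)).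
  by rewrite mulr_ge0 // mulr_ge0 // sqr_ge0.
move=> N N0; have [x [x0 xN xE xA]] := exists_polygon Blin Bskew b0 bP hor eta0 N0.
exists x; split; rewrite ?x0 ?xN ?g0 ?g1 //.
  apply: le_trans xE _; nra.
by move: xA; rewrite g0 g1 sub0r -opprD norm1N.
Qed.

(** * Correcting the area of a polygon *)

Section Correction.
Variables (R : realType) (m n2 : nat).

(* [m.+1] complex unknowns against [m] complex equations
   [\sum_r (al r - i be r) (y r + i y' r) = 0]. *)
Lemma null_combination (y y' : 'I_m.+1 -> 'rV[R]_m) :
  exists al be : 'I_m.+1 -> R,
  [/\ \sum_r (al r ^+ 2 + be r ^+ 2) = 1,
      \sum_r (al r *: y r + be r *: y' r) = 0 &
      \sum_r (al r *: y' r - be r *: y r) = 0].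
Proof.
pose Y : 'M[R]_(m.+1, m) := \matrix_(r < m.+1) y r.
pose Y' : 'M[R]_(m.+1, m) := \matrix_(r < m.+1) y' r.
pose M := block_mx Y Y' Y' (- Y).
(* [M] has [2m + 2] rows and [2m] columns, so its rows are dependent. *)
have : kermx M != 0.
  rewrite kermx_eq0 /row_free; apply/negP => /eqP e.
  by have := rank_leq_col M; rewrite e addnS ltnNge addSn leqnSn.
case/rowV0Pn => v /sub_kermxP vM v0.
pose c := enorm v.
have c0 : c != 0.
  apply: contra v0 => /eqP c0; apply/eqP/dotvv_eq0.
  by rewrite -sqr_enorm -/c c0 expr0n.
have mulE (a : 'rV[R]_m.+1) (z : 'I_m.+1 -> 'rV[R]_m) :
    a *m (\matrix_(r < m.+1) z r) = \sum_r a 0 r *: z r.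
  by rewrite mulmx_sum_row; apply: eq_bigr => r _; rewrite rowK.
move: vM; rewrite -[v]hsubmxK mul_row_block -row_mx0 => /eq_row_mx [].
rewrite mulmxN !mulE => e1 e2.
exists (fun r => c^-1 * lsubmx v 0 r), (fun r => c^-1 * rsubmx v 0 r); split.
- rewrite (eq_bigr (fun r => c^-1 ^+ 2 * (lsubmx v 0 r ^+ 2 + rsubmx v 0 r ^+ 2))).
    rewrite -mulr_sumr big_split /=.
    have -> : \sum_r lsubmx v 0 r ^+ 2 + \sum_r rsubmx v 0 r ^+ 2 = c ^+ 2.
      rewrite /c sqr_enorm /dotv big_split_ord /=.
      by congr (_ + _); apply: eq_bigr => r _; rewrite mxE expr2.
    by rewrite -exprMn mulVf // expr1n.
  by move=> r _; rewrite !exprMn mulrDr.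
- rewrite (eq_bigr (fun r => c^-1 *: (lsubmx v 0 r *: y r + rsubmx v 0 r *: y' r))).
    by rewrite -scaler_sumr big_split /= e1 scaler0.
  by move=> r _; rewrite scalerDr !scalerA.
- rewrite (eq_bigr (fun r => c^-1 *: (lsubmx v 0 r *: y' r - rsubmx v 0 r *: y r))).
    by rewrite -scaler_sumr sumrB /= e2 scaler0.
  by move=> r _; rewrite scalerBr !scalerA.
Qed.

Variable B : 'rV[R]_m -> 'rV[R]_m -> 'rV[R]_n2.
Hypothesis Blin : forall (a : R) x y z, B (a *: x + y) z = a *: B x z + B y z.
Hypothesis Bskew : forall x y, B x y = - B y x.
Hypothesis Bspan : forall v : 'rV[R]_n2,
  exists k (c : 'I_k -> R) (x y : 'I_k -> 'rV[R]_m),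
    v = \sum_(i < k) c i *: B (x i) (y i).

(** Expand each basis vector once and for all by [Bspan]. Each resulting scalar [a] is split as
    [sg a * sqrt |a|] on one factor and [sqrt |a|] on the other, which makes the squared norms
    linear in [q]. *)
Lemma bil_decomposition : exists (T : finType) (C : R), 0 <= C /\
  forall q : 'rV[R]_n2, exists xi eta : T -> 'rV[R]_m,
    q = \sum_t B (xi t) (eta t) /\
    \sum_t (enorm (xi t) ^+ 2 + enorm (eta t) ^+ 2) <= C * norm1 q.
Proof.
have /choice[f fP] : forall j : 'I_n2,
    exists f : nat * (nat -> R * ('rV[R]_m * 'rV[R]_m)),
    delta_mx 0 j = \sum_(i < f.1) (f.2 i).1 *: B (f.2 i).2.1 (f.2 i).2.2.
  move=> j; have [k [c [x [y e]]]] := Bspan (delta_mx 0 j).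
  exists (k, fun n => if (insub n : option 'I_k) is Some i then (c i, (x i, y i))
                      else (0, (0, 0))).
  by rewrite /= {1}e; apply: eq_bigr => i _; rewrite valK.
pose T := {j : 'I_n2 & 'I_(f j).1}.
pose c (t : T) := ((f (tag t)).2 (tagged t)).1.
pose x (t : T) := ((f (tag t)).2 (tagged t)).2.1.
pose y (t : T) := ((f (tag t)).2 (tagged t)).2.2.
exists T, (\sum_t `|c t| * (enorm (x t) ^+ 2 + enorm (y t) ^+ 2)); split.
  by apply: sumr_ge0 => t _; rewrite mulr_ge0 // addr_ge0 // sqr_ge0.
move=> q; pose a (t : T) := q 0 (tag t) * c t.
exists (fun t => (Num.sg (a t) * Num.sqrt `|a t|) *: x t), (fun t => Num.sqrt `|a t| *: y t).
split.
  rewrite {1}(row_sum_delta q).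
  rewrite (eq_bigr (fun j => \sum_(i < (f j).1)
      (q 0 j * ((f j).2 i).1) *: B ((f j).2 i).2.1 ((f j).2 i).2.2)); last first.
    by move=> j _; rewrite {1}fP scaler_sumr; apply: eq_bigr => i _; rewrite scalerA.
  rewrite sig_big_dep /=; apply: eq_bigr => t _.
  rewrite (bilZl Blin) (bilZr Blin Bskew) scalerA -mulrA -expr2 sqr_sqrtr //.
  by rewrite -numEsg.
rewrite mulr_suml; apply: ler_sum => t _.
rewrite !enormZ !exprMn !real_normK ?num_real // exprMn sqr_sqrtr //.
have sg1 : Num.sg (a t) ^+ 2 <= 1.
  by rewrite sqr_sg; case: (a t != 0).
have at0 : `|a t| <= `|c t| * norm1 q.
  rewrite normrM mulrC ler_wpM2l // /norm1 (bigD1 (tag t)) //= lerDl.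
  exact: sumr_ge0.
apply: le_trans (_ : `|a t| * (enorm (x t) ^+ 2 + enorm (y t) ^+ 2) <= _).
  rewrite mulrDr lerD2r ler_wpM2r ?sqr_ge0 // ler_piMl //.
by rewrite [leRHS]mulrAC ler_wpM2r // addr_ge0 // sqr_ge0.
Qed.

(* The scalars of [null_combination] turn one summand [B xi eta] into [m.+1]
   summands with the same total, the same squared norm, and vanishing
   pairing against [y] and [y']. *)
Lemma bil_correction_fin : exists (S : finType) (C : R), 0 <= C /\
  forall (y y' : S -> 'rV[R]_m) (q : 'rV[R]_n2), exists zeta eta : S -> 'rV[R]_m,
  [/\ \sum_s B (zeta s) (eta s) = q,
      \sum_s (B (zeta s) (y s) + B (eta s) (y' s)) = 0 &
      \sum_s (enorm (zeta s) ^+ 2 + enorm (eta s) ^+ 2) <= C * norm1 q].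
Proof.
have [T [C [C0 dec]]] := bil_decomposition.
exists (T * 'I_m.+1)%type, C; split=> // y y' q.
have [xi [eta [-> le_q]]] := dec q.
have /choice[ab abP] : forall t : T, exists ab : ('I_m.+1 -> R) * ('I_m.+1 -> R),
    [/\ \sum_r (ab.1 r ^+ 2 + ab.2 r ^+ 2) = 1,
      \sum_r (ab.1 r *: y (t, r) + ab.2 r *: y' (t, r)) = 0 &
      \sum_r (ab.1 r *: y' (t, r) - ab.2 r *: y (t, r)) = 0].
  move=> t; have [al [be h]] := null_combination (fun r => y (t, r)) (fun r => y' (t, r)).
  by exists (al, be).
pose al (s : T * 'I_m.+1) := (ab s.1).1 s.2.
pose be (s : T * 'I_m.+1) := (ab s.1).2 s.2.
(* Multiplying [xi + i eta] by [al + i be] multiplies both [B xi eta] and the squared norm by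
   [al^2 + be^2], and these factors sum to 1 over [r]. *)
exists (fun s => al s *: xi s.1 - be s *: eta s.1), (fun s => be s *: xi s.1 + al s *: eta s.1).
split.
- rewrite -(pair_bigA _ (fun t r => B (al (t, r) *: xi t - be (t, r) *: eta t)
    (be (t, r) *: xi t + al (t, r) *: eta t))) /=; apply: eq_bigr => t _.
  have [e _ _] := abP t; rewrite -[RHS]scale1r -e scaler_suml; apply: eq_bigr => r _.
  rewrite (bilDl Blin) (bilNl Blin) !(bilDr Blin Bskew) !(bilZl Blin) !(bilZr Blin Bskew).
  rewrite !(bilxx Bskew) (Bskew (eta t)) !scaler0 addr0 add0r !scalerN opprK !scalerA.
  by rewrite -scalerDl !expr2.
- pose F t r := B (al (t, r) *: xi t - be (t, r) *: eta t) (y (t, r)) +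
    B (be (t, r) *: xi t + al (t, r) *: eta t) (y' (t, r)).
  rewrite (eq_bigr (fun s => F s.1 s.2)) => [|[t r] _ //]; rewrite -pair_bigA /=.
  rewrite big1 // => t _; have [_ e1 e2] := abP t.
  transitivity (B (xi t) (\sum_r (al (t, r) *: y (t, r) + be (t, r) *: y' (t, r))) +
    B (eta t) (\sum_r (al (t, r) *: y' (t, r) - be (t, r) *: y (t, r)))).
    rewrite !(bil_sumr Blin Bskew) -big_split; apply: eq_bigr => r _ /=.
    rewrite /F !(bilDl Blin) !(bilNl Blin) !(bilDr Blin Bskew) (bilNr Blin Bskew).
    rewrite !(bilZl Blin) !(bilZr Blin Bskew).
    by rewrite addrACA; congr (_ + _); rewrite addrC.
  by rewrite e1 e2 !(bil0r Blin Bskew) addr0.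
- apply: le_trans le_q; rewrite le_eqVlt; apply/orP; left; apply/eqP.
  rewrite -(pair_bigA _ (fun t r => enorm (al (t, r) *: xi t - be (t, r) *: eta t) ^+ 2 +
    enorm (be (t, r) *: xi t + al (t, r) *: eta t) ^+ 2)) /=; apply: eq_bigr => t _.
  have [e _ _] := abP t; rewrite -[RHS]mul1r -e mulr_suml; apply: eq_bigr => r _.
  rewrite !sqr_enorm !dotvDl !dotvDr !dotvNl !dotvNr !dotvZl !dotvZr (dotvC (eta t) (xi t)).
  rewrite /al /be /=; ring.
Qed.

Lemma bil_correction : (0 < n2)%N -> exists (S : nat) (C : R), [/\ (0 < S)%N, 0 <= C &
  forall (y y' : nat -> 'rV[R]_m) (q : 'rV[R]_n2), exists zeta eta : nat -> 'rV[R]_m,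
  [/\ \sum_(s < S) B (zeta s) (eta s) = q,
      \sum_(s < S) (B (zeta s) (y s) + B (eta s) (y' s)) = 0 &
      \sum_(s < S) (enorm (zeta s) ^+ 2 + enorm (eta s) ^+ 2) <= C * norm1 q]].
Proof.
move=> n2_gt0; have [S [C [C0 cor]]] := bil_correction_fin.
exists #|S|, C; split=> //.
  (* With an empty index set only the area 0 could be reached, while [const_mx 1] is nonzero. *)
  rewrite lt0n; apply/negP => /eqP/card0_eq S0.
  have [z [e [h _ _]]] := cor (fun=> 0) (fun=> 0) (const_mx 1).
  move/rowP: h => /(_ (Ordinal n2_gt0)) /eqP; rewrite big_pred0 ?mxE 1?eq_sym ?oner_eq0 //.
move=> y y' q.
have [z [e [h1 h2 h3]]] := cor (fun s => y (enum_rank s)) (fun s => y' (enum_rank s)) q.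
pose ext (f : S -> 'rV[R]_m) (n : nat) : 'rV[R]_m :=
  if (insub n : option 'I_#|S|) is Some i then f (enum_val i) else 0.
have extE f (i : 'I_#|S|) : ext f i = f (enum_val i) by rewrite /ext valK.
exists (ext z), (ext e); split.
- rewrite -h1 (reindex _ (onW_bij _ (enum_val_bij S))); apply: eq_bigr => i _; by rewrite !extE.
- rewrite -[RHS]h2 (reindex _ (onW_bij _ (enum_val_bij S))); apply: eq_bigr => i _.
  by rewrite !extE enum_valK.
- apply: le_trans h3; rewrite [X in _ <= X](reindex _ (onW_bij _ (enum_val_bij S))).
  rewrite le_eqVlt; apply/orP; left; apply/eqP.
  by apply: eq_bigr => i _; rewrite !extE.
Qed.

End Correction.

(** * Variations of area and energy, and the correcting polygon *)

Lemma sum_blocks (V : nmodType) (K M : nat) (F : nat -> V) :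
  \sum_(j < (K * M)%N) F j = \sum_(b < K) \sum_(r < M) F (b * M + r)%N.
Proof.
elim: K => [|K IH]; first by rewrite !big_ord0.
by rewrite big_ord_recr /= -IH mulSnr big_split_ord.
Qed.

Section Variation.
Variables (R : realType) (m n2 : nat) (B : 'rV[R]_m -> 'rV[R]_m -> 'rV[R]_n2).
Hypothesis Blin : forall (a : R) x y z, B (a *: x + y) z = a *: B x z + B y z.
Hypothesis Bskew : forall x y, B x y = - B y x.
Implicit Types (x v w a : nat -> 'rV[R]_m).

Definition incr x (j : nat) : 'rV[R]_m := x j.+1 - x j.

(** First variation of [area] at a polygon with increments [a], after a summation by parts whose
    boundary terms appear in [areaD]. *)
Definition darea N v a : 'rV[R]_n2 := \sum_(j < N) B (v j + v j.+1) (a j).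

(** Half the first variation of [energy]. *)
Definition denergy N v a : R := N%:R * \sum_(j < N) dotv (a j) (incr v j).

Lemma areaD N x v :
  area B N (fun j => x j + v j) =
  area B N x + darea N v (incr x) + area B N v + (B (v 0%N) (x 0%N) - B (v N) (x N)).
Proof.
rewrite /area /darea /incr; elim: N => [|N IH].
  by rewrite !big_ord0 subrr !addr0.
rewrite !big_ord_recr /= IH !(bilDl Blin) !(bilDr Blin Bskew) !(bilNr Blin Bskew).
rewrite (Bskew (x N) (v N.+1)).
by apply/rowP => k; rewrite !mxE; ring.
Qed.

Lemma energyD N x v :
  energy N (fun j => x j + v j) = energy N x + 2 * denergy N v (incr x) + energy N v.
Proof.
rewrite /energy /denergy mulrCA -!mulrDr; congr (_ * _); rewrite mulr_sumr -!big_split.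
apply: eq_bigr => j _; rewrite /= !sqr_enorm /incr.
rewrite opprD addrACA; move: (x j.+1 - x j) (v j.+1 - v j) => a b.
rewrite dotvDl !dotvDr (dotvC b a); ring.
Qed.

Lemma areaN N v : area B N (fun j => - v j) = area B N v.
Proof.
by apply: eq_bigr => j _; rewrite (bilNl Blin) (bilNr Blin Bskew) opprK.
Qed.

Lemma dareaN N v a : darea N (fun j => - v j) a = - darea N v a.
Proof.
rewrite /darea -sumrN; apply: eq_bigr => j _.
by rewrite -opprD (bilNl Blin).
Qed.

Lemma denergyN N v a : denergy N (fun j => - v j) a = - denergy N v a.
Proof.
rewrite /denergy -mulrN -sumrN; congr (_ * _); apply: eq_bigr => j _.
by rewrite -dotvNr /incr -opprD.
Qed.

Lemma energyN N v : energy N (fun j => - v j) = energy N v.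
Proof.
by congr (_ * _); apply: eq_bigr => j _; rewrite -opprD enormN.
Qed.

Section Interpolation.
Variables (M : nat) (M_gt0 : (0 < M)%N) (P : nat -> 'rV[R]_m).

(** Cuts every edge of [P] into [M] equal pieces. Area and energy do not change, so a polygon with a
    fixed number of edges can be added to one with arbitrarily many. *)
Definition interp (j : nat) : 'rV[R]_m :=
  P (j %/ M) + ((j %% M)%:R / M%:R) *: incr P (j %/ M).

Let Mr0 : M%:R != 0 :> R. Proof. by rewrite pnatr_eq0 -lt0n. Qed.

Lemma interpE b r : (r <= M)%N -> interp (b * M + r)%N = P b + (r%:R / M%:R) *: incr P b.
Proof.
rewrite leq_eqVlt => /predU1P[->|rM].
  rewrite -mulSnr /interp mulnK // modnMl mul0r scale0r addr0 divff //.
  by rewrite scale1r /incr addrC subrK.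
by rewrite /interp divnMDl // divn_small // addn0 modnMDl modn_small.
Qed.

Lemma interp_node b : interp (b * M)%N = P b.
Proof. by rewrite -[(b * M)%N]addn0 interpE // mul0r scale0r addr0. Qed.

Lemma incr_interp b r : (r < M)%N -> incr interp (b * M + r)%N = M%:R^-1 *: incr P b.
Proof.
move=> rM; rewrite /incr -addnS !interpE ?(ltnW rM) // opprD addrACA subrr add0r.
by rewrite -scalerBl -mulrBl -natr1 addrAC subrr add0r mul1r.
Qed.

Lemma area_interp K : area B (K * M)%N interp = area B K P.
Proof.
rewrite /area (sum_blocks K M (fun j => B (interp j) (interp j.+1))).
apply: eq_bigr => b _.
transitivity (\sum_(r < M) M%:R^-1 *: B (P b) (P b.+1)).
  apply: eq_bigr => r _; rewrite -addnS !interpE ?(ltnW (ltn_ord r)) //.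
  rewrite !(bilDl Blin) !(bilDr Blin Bskew) !(bilZl Blin) !(bilZr Blin Bskew).
  rewrite /incr !(bilDl Blin) !(bilDr Blin Bskew) !(bilNl Blin) !(bilNr Blin Bskew).
  rewrite !(bilxx Bskew) (Bskew (P b.+1)) -natr1.
  by apply/rowP => k; rewrite !mxE; ring.
by rewrite -scaler_suml sumr_const card_ord -[X in X *: _]mulr_natr mulVf // scale1r.
Qed.

Lemma energy_interp K : energy (K * M)%N interp = energy K P.
Proof.
rewrite /energy (sum_blocks K M (fun j => enorm (interp j.+1 - interp j) ^+ 2)).
rewrite natrM -mulrA; congr (_ * _); rewrite mulr_sumr.
apply: eq_bigr => b _.
rewrite (eq_bigr (fun=> M%:R^-1 ^+ 2 * enorm (incr P b) ^+ 2)) => [|r _]; last first.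
  rewrite -[_ - _]/(incr interp (b * M + r)) incr_interp // enormZ exprMn.
  by rewrite ger0_norm // invr_ge0.
by rewrite sumr_const card_ord -mulr_natl /incr; field.
Qed.

(** The weights here and in [moment_right] are the coefficients of [P b] and [P b.+1] in
    [interp j + interp j.+1] for [j = b * M + r]. *)
Definition moment_left a (b : nat) : 'rV[R]_m :=
  \sum_(r < M) (2 - (2 * r%:R + 1) / M%:R) *: a (b * M + r)%N.
Definition moment_right a (b : nat) : 'rV[R]_m :=
  \sum_(r < M) ((2 * r%:R + 1) / M%:R) *: a (b * M + r)%N.

Lemma darea_interp K a :
  darea (K * M)%N interp a =
  \sum_(b < K) (B (P b) (moment_left a b) + B (P b.+1) (moment_right a b)).
Proof.
rewrite /darea (sum_blocks K M (fun j => B (interp j + interp j.+1) (a j))).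
apply: eq_bigr => b _.
rewrite !(bil_sumr Blin Bskew) -big_split; apply: eq_bigr => r _ /=.
rewrite -addnS !interpE ?(ltnW (ltn_ord r)) // !(bilZr Blin Bskew).
rewrite !(bilDl Blin) !(bilZl Blin) /incr !(bilDl Blin) !(bilNl Blin) -natr1.
by apply/rowP => k; rewrite !mxE; ring.
Qed.

End Interpolation.

(** A chain of loops [0, zeta s, eta s, 0]; only the middle edge of each has nonzero area, namely
    [B (zeta s) (eta s)]. *)
Definition triangles (zeta eta : nat -> 'rV[R]_m) (n : nat) : 'rV[R]_m :=
  match (n %% 3)%N with 1 => zeta (n %/ 3)%N | 2 => eta (n %/ 3)%N | _ => 0 end.

Lemma trianglesE zeta eta b :
  [/\ triangles zeta eta (b * 3)%N = 0, triangles zeta eta (b * 3 + 1)%N = zeta b,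
      triangles zeta eta (b * 3 + 2)%N = eta b & triangles zeta eta (b * 3 + 3)%N = 0].
Proof.
split.
- by rewrite /triangles modnMl.
- by rewrite /triangles modnMDl divnMDl // addn0.
- by rewrite /triangles modnMDl divnMDl // addn0.
- by rewrite /triangles -mulSnr modnMl.
Qed.

Lemma area_triangles S zeta eta :
  area B (S * 3)%N (triangles zeta eta) = \sum_(s < S) B (zeta s) (eta s).
Proof.
set P := triangles zeta eta.
rewrite /area (sum_blocks S 3 (fun j => B (P j) (P j.+1))); apply: eq_bigr => s _.
rewrite !big_ord_recr big_ord0 /= add0r -!addnS addn0 /P.
have [-> -> -> ->] := trianglesE zeta eta s.
by rewrite (bil0l Blin) (bil0r Blin Bskew) addr0 add0r.
Qed.

Lemma energy_triangles S zeta eta :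
  energy (S * 3)%N (triangles zeta eta) <=
  (S * 3)%:R * 3 * \sum_(s < S) (enorm (zeta s) ^+ 2 + enorm (eta s) ^+ 2).
Proof.
set P := triangles zeta eta; rewrite /energy (sum_blocks S 3 (fun j => enorm (P j.+1 - P j) ^+ 2)).
rewrite -mulrA ler_wpM2l // mulr_sumr; apply: ler_sum => s _.
rewrite !big_ord_recr big_ord0 /= add0r -!addnS addn0 /P.
have [-> -> -> ->] := trianglesE zeta eta s.
rewrite subr0 sub0r enormN !sqr_enorm dotvDl !dotvDr !dotvNl !dotvNr (dotvC (eta s)).
have := dotv_ge0 (zeta s + eta s); rewrite dotvDl !dotvDr (dotvC (eta s)).
lra.
Qed.

Hypothesis Bspan : forall v : 'rV[R]_n2,
  exists k (c : 'I_k -> R) (x y : 'I_k -> 'rV[R]_m),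
    v = \sum_(i < k) c i *: B (x i) (y i).
Hypothesis n2_gt0 : (0 < n2)%N.

(* The variation [v] is critical for the area, so both [v] and [- v] produce the
   same area, and one of the two does not increase the energy to first order. *)
Lemma area_correction : exists (K : nat) (C : R), [/\ (0 < K)%N, 0 <= C &
  forall M, (0 < M)%N -> forall x (q : 'rV[R]_n2), exists v : nat -> 'rV[R]_m,
  [/\ v 0%N = 0, v (K * M)%N = 0,
      area B (K * M)%N (fun j => x j + v j) = area B (K * M)%N x + q &
      energy (K * M)%N (fun j => x j + v j) <= energy (K * M)%N x + C * norm1 q]].
Proof.
have [S [C [S0 C0 cor]]] := bil_correction Blin Bskew Bspan n2_gt0.
exists (S * 3)%N, ((S * 3)%:R * 3 * C); split; first by rewrite muln_gt0 S0.
  by rewrite mulr_ge0.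
move=> M M0 x q; set N := (S * 3 * M)%N.
pose Zl := moment_left M (incr x); pose Zr := moment_right M (incr x).
(* Vertex [s * 3 + 1], which carries [zeta s], is the left end of edge [s * 3 + 1] and the right end
   of edge [s * 3]; for [eta s] everything moves by one edge. With these moments [hL] says that
   [darea] vanishes. *)
have [zeta [eta [hA hL hE]]] := cor (fun s => Zl (s * 3 + 1)%N + Zr (s * 3)%N)
  (fun s => Zl (s * 3 + 2)%N + Zr (s * 3 + 1)%N) q.
pose v := interp M (triangles zeta eta).
have v0 : v 0%N = 0 by have := interp_node M0 (triangles zeta eta) 0; rewrite mul0n; apply.
have vN : v N = 0 by rewrite /v interp_node //; have [-> _ _ _] := trianglesE zeta eta S.
have vA : area B N v = q by rewrite area_interp // area_triangles.
have vL : darea N v (incr x) = 0.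
  rewrite darea_interp //; set P := triangles zeta eta.
  rewrite (sum_blocks S 3 (fun b => B (P b) (Zl b) + B (P b.+1) (Zr b))) -[RHS]hL.
  apply: eq_bigr => s _.
  rewrite !big_ord_recr big_ord0 /= add0r -!addnS addn0 /P.
  have [-> -> -> ->] := trianglesE zeta eta s.
  rewrite !(bil0l Blin) !(bilDr Blin Bskew) add0r addr0 -/Zl -/Zr.
  by apply/rowP => k; rewrite !mxE; ring.
have vE : energy N v <= (S * 3)%:R * 3 * C * norm1 q.
  rewrite energy_interp //; apply: le_trans (energy_triangles _ _ _) _.
  by rewrite -[leRHS]mulrA ler_wpM2l // mulr_ge0.
clearbody v; have [le0|ge0] := leP (denergy N v (incr x)) 0.
- exists v; split=> //; rewrite ?areaD ?energyD.
    by rewrite v0 vN vL vA !(bil0l Blin) subr0 !addr0.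
  lra.
- exists (fun j => - v j); split; rewrite ?v0 ?vN ?oppr0 ?areaD ?energyD ?areaN ?dareaN //.
    by rewrite v0 vN vL vA !oppr0 !(bil0l Blin) subr0 !addr0.
  rewrite energyN denergyN; lra.
Qed.

(** Correcting the area defect by [area_correction] turns every polygon from [p.1] to 0 into a
    competitor, so the area constraint becomes a penalty. *)
Lemma sqr_ccdist_le_area : exists (K : nat) (C : R), [/\ (0 < K)%N, 0 <= C &
  forall M, (0 < M)%N -> forall (p : pt R m n2) x, x 0%N = p.1 -> x (K * M)%N = 0 ->
    (ccdistE B p (0%R, 0%R) < +oo)%E /\
    ccdist B p (0, 0) ^+ 2 <=
    energy (K * M)%N x + C * norm1 (p.2 + area B (K * M)%N x)].
Proof.
have [K [C [K0 C0 cor]]] := area_correction.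
exists K, C; split=> // M M0 p x x0 xN.
have N0 : (0 < K * M)%N by rewrite muln_gt0 K0.
have [v [v0 vN vA vE]] := cor M M0 x (- (p.2 + area B (K * M)%N x)).
have yA : p.2 + area B (K * M)%N (fun j => x j + v j) = 0.
  by rewrite vA addrA subrr.
have y0 : x 0%N + v 0%N = p.1 by rewrite v0 addr0.
have yN : x (K * M)%N + v (K * M)%N = 0 by rewrite vN addr0.
split; first exact: (ccdistE_lty Blin Bskew N0 y0 yN yA).
apply: le_trans (sqr_ccdist_polygon Blin Bskew N0 y0 yN yA) _.
by move: vE; rewrite norm1N.
Qed.

End Variation.

Lemma dotvE (R : realType) k (u v : 'rV[R]_k) : u *m v^T = (dotv u v)%:M.
Proof.
apply/matrixP => i j; rewrite !ord1 !mxE /= mulr1n.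
by apply: eq_bigr => l _; rewrite mxE.
Qed.

(** * Lagrange multipliers *)

Section RidgeRegression.
Variables (R : realType) (n2 : nat) (T : finType) (l : T -> R) (g : T -> 'rV[R]_n2).

(** These are the normal equations; the term [d%:M] makes their matrix positive definite, hence
    invertible. *)
Lemma ridge_regression (d : R) : 0 < d ->
  exists la : 'rV[R]_n2, \sum_t (l t - dotv la (g t)) *: g t = d *: la.
Proof.
move=> d0; pose Q : 'M[R]_n2 := \sum_t (g t)^T *m g t + d%:M.
have mulQ (x : 'rV[R]_n2) : x *m Q = \sum_t dotv x (g t) *: g t + d *: x.
  rewrite mulmxDr mul_mx_scalar mulmx_sumr; congr (_ + _); apply: eq_bigr => t _.
  by rewrite mulmxA dotvE mul_scalar_mx.
have Qunit : Q \in unitmx.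
  rewrite -row_free_unit -kermx_eq0; apply/rowV0P => x /sub_kermxP xQ.
  apply: dotvv_eq0; apply/eqP; rewrite eq_le dotv_ge0 andbT -(pmulr_rle0 _ d0).
  have : dotv x (x *m Q) = 0 by rewrite xQ dotvC dot0v.
  rewrite mulQ dotvDr dotvZr dotv_sumr => e.
  have : 0 <= \sum_t dotv x (dotv x (g t) *: g t).
    by apply: sumr_ge0 => t _; rewrite dotvZr -expr2 sqr_ge0.
  lra.
exists ((\sum_t l t *: g t) *m invmx Q); set la := _ *m _.
have : la *m Q = \sum_t l t *: g t by rewrite mulmxKV.
rewrite mulQ => e; under eq_bigr do rewrite scalerBl.
by rewrite sumrB -e addrAC subrr add0r.
Qed.

(* Lagrange multipliers for a near-minimizer: [la] and the residual are those of
   the least-squares problem regularized by [d *: |la|^2], and testing the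
   hypothesis on a multiple of the residual bounds them both. *)
Lemma lagrange_multiplier (d C C2 : R) : 0 < d -> 0 <= C -> 0 < C2 ->
  (forall z : T -> R, 0 <= 2 * d + 2 * (\sum_t z t * l t) +
      C * norm1 (\sum_t z t *: g t) + C2 * (\sum_t z t ^+ 2)) ->
  exists la : 'rV[R]_n2,
    enorm la ^+ 2 <= 2 * C2 + (C * n2%:R) ^+ 2 /\
    \sum_t (l t - dotv la (g t)) ^+ 2 <= d * (2 * C2 + (C * n2%:R) ^+ 2).
Proof.
move=> d0 C0 C20 H; have [la laE] := ridge_regression d0.
exists la; pose r t := l t - dotv la (g t); rewrite -/(r _) in laE *.
set r2 := \sum_t r t ^+ 2.
have r20 : 0 <= r2 by apply: sumr_ge0 => t _; exact: sqr_ge0.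
have lr : \sum_t r t * l t = r2 + d * enorm la ^+ 2.
  rewrite sqr_enorm -dotvZr -laE dotv_sumr -big_split; apply: eq_bigr => t _ /=.
  by rewrite dotvZr /r; ring.
(* For this test vector the pairing with [l] is given by [lr], and the ridge equation turns the
   combination of the [g t] into [- (d / C2) la], so the penalty is of order [d]. *)
have := H (fun t => - (C2^-1 * r t)).
rewrite (eq_bigr (fun t => - C2^-1 * (r t * l t))) => [|t _]; last by ring.
rewrite -mulr_sumr lr.
rewrite [X in norm1 X](_ : _ = - (C2^-1 * d) *: la); last first.
  rewrite scaleNr -scalerA -laE scaler_sumr -sumrN; apply: eq_bigr => t _.
  by rewrite scaleNr scalerA.
rewrite [X in C2 * X](_ : _ = C2^-1 ^+ 2 * r2); last first.
  by rewrite mulr_sumr; apply: eq_bigr => t _; rewrite sqrrN exprMn.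
rewrite norm1Z normrN ger0_norm; last by rewrite mulr_ge0 ?invr_ge0 ?ltW.
have n1 := ler_norm1_enorm la; have e0 := enorm_ge0 la.
move: (enorm la) n1 e0 => e n1 e0 h.
have key : r2 + 2 * d * e ^+ 2 <= 2 * C2 * d + (C * n2%:R) * d * e.
  have h2 : C * (C2^-1 * d * norm1 la) <= C2^-1 * (C * n2%:R * d * e).
    have -> : C2^-1 * (C * n2%:R * d * e) = C * (C2^-1 * d * (n2%:R * e)) by ring.
    by rewrite ler_wpM2l // ler_wpM2l // mulr_ge0 ?invr_ge0 ?(ltW d0) ?(ltW C20).
  rewrite -subr_ge0.
  have -> : 2 * C2 * d + C * n2%:R * d * e - (r2 + 2 * d * e ^+ 2) =
     C2 * (2 * d + 2 * (- C2^-1 * (r2 + d * e ^+ 2)) + C2^-1 * (C * n2%:R * d * e) +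
     C2 * (C2^-1 ^+ 2 * r2)).
    by field; rewrite gt_eqF.
  apply: mulr_ge0; first exact: ltW.
  by apply: le_trans h _; rewrite lerD2r lerD2l.
have c0 : 0 <= C * n2%:R by rewrite mulr_ge0.
move: (C * n2%:R) c0 key => c c0 key.
have dc : 0 <= d * c ^+ 2 by rewrite mulr_ge0 ?sqr_ge0 // ltW.
(* Completing squares absorbs [c * e] into the term [2 * e ^+ 2] of [key]. *)
have sq2 : 0 <= d * (e - c / 2) ^+ 2 by rewrite mulr_ge0 ?sqr_ge0 // ltW.
have sq4 : 0 <= d * (e - c / 4) ^+ 2 by rewrite mulr_ge0 ?sqr_ge0 // ltW.
split; last by lra.
by rewrite -(ler_pM2l d0); lra.
Qed.

End RidgeRegression.

(** * Polynomials and the Cayley-Hamilton theorem *)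

Section PolynomialEstimates.
Variable R : realType.
Implicit Types p q : {poly R}.

Lemma poly_bounded p : exists2 L : R, 0 <= L & forall x, 0 <= x <= 1 -> `|p.[x]| <= L.
Proof.
elim/poly_ind: p => [|p c [L L0 LP]].
  by exists 0 => // x _; rewrite horner0 normr0.
exists (L + `|c|); first by rewrite addr_ge0.
move=> x x01; rewrite !hornerE; apply: le_trans (ler_normD _ _) _.
rewrite lerD2r normrM; case/andP: (x01) => x0 x1.
by rewrite -[L]mulr1 ler_pM // ?LP // ger0_norm.
Qed.

(** Horner induction: the remainder of [p * 'X + c] is [y] times that of [p] plus
    [p'(x) (y - x)^2]. *)
Lemma poly_taylor p : exists2 L : R, 0 <= L & forall x y, 0 <= x <= 1 -> 0 <= y <= 1 ->
  `|p.[y] - p.[x] - (y - x) * p^`().[x]| <= L * (y - x) ^+ 2.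
Proof.
elim/poly_ind: p => [|p c [L L0 LP]].
  by exists 0 => // x y _ _; rewrite deriv0 !horner0 !(subr0, mulr0, mul0r) normr0.
have [L' L'0 LP'] := poly_bounded p^`().
exists (L + L'); first by rewrite addr_ge0.
move=> x y x01 y01; rewrite derivMXaddC !hornerMXaddC hornerD hornerM hornerX.
have -> : p.[y] * y + c - (p.[x] * x + c) - (y - x) * (p.[x] + p^`().[x] * x) =
    y * (p.[y] - p.[x] - (y - x) * p^`().[x]) + p^`().[x] * (y - x) ^+ 2 by ring.
apply: le_trans (ler_normD _ _) _; rewrite (normrM y) (normrM p^`().[x]) (mulrDl L).
rewrite (ger0_norm (sqr_ge0 (y - x))); apply: lerD; last first.
  by rewrite ler_wpM2r ?sqr_ge0 // LP'.
case/andP: (y01) => y0 y1; rewrite -[leRHS]mul1r ler_pM // ?LP // ger0_norm //.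
Qed.

Lemma poly_lipschitz p : exists2 L : R, 0 <= L & forall x y, 0 <= x <= 1 -> 0 <= y <= 1 ->
  `|p.[y] - p.[x]| <= L * `|y - x|.
Proof.
have [L L0 LP] := poly_taylor p; have [L' L'0 LP'] := poly_bounded p^`().
exists (L + L'); first by rewrite addr_ge0.
move=> x y x01 y01; have := LP x y x01 y01; have := LP' x x01.
have yx1 : `|y - x| <= 1 by case/andP: x01; case/andP: y01 => *; rewrite ler_norml; lra.
move=> h1 h2.
have -> : p.[y] - p.[x] = (p.[y] - p.[x] - (y - x) * p^`().[x]) + (y - x) * p^`().[x].
  by rewrite subrK.
apply: le_trans (ler_normD _ _) _; rewrite (mulrDl L); apply: lerD.
  apply: le_trans h2 _; rewrite ler_wpM2l // -real_normK ?num_real // expr2.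
  by rewrite ler_piMl.
by rewrite normrM mulrC ler_wpM2r.
Qed.

(** Taylor at [x] combined with the Lipschitz bound for [p']. It serves to compare difference
    quotients of [p] with averages of [p'] on a cell. *)
Lemma poly_trapezoid p : exists2 L : R, 0 <= L & forall x y, 0 <= x <= 1 -> 0 <= y <= 1 ->
  `|2 * (p.[y] - p.[x]) - (y - x) * (p^`().[x] + p^`().[y])| <= L * (y - x) ^+ 2.
Proof.
have [L L0 LP] := poly_taylor p; have [L' L'0 LP'] := poly_lipschitz p^`().
exists (2 * L + L'); first by rewrite addr_ge0 // mulr_ge0.
move=> x y x01 y01.
have -> : 2 * (p.[y] - p.[x]) - (y - x) * (p^`().[x] + p^`().[y]) =
  2 * (p.[y] - p.[x] - (y - x) * p^`().[x]) - (y - x) * (p^`().[y] - p^`().[x]) by ring.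
apply: le_trans (ler_normB _ _) _; rewrite !normrM (mulrDl (2 * L)); apply: lerD.
  by rewrite ger0_norm // -mulrA ler_wpM2l // LP.
rewrite -(real_normK (num_real (y - x))) expr2 mulrCA ler_wpM2l //.
exact: LP'.
Qed.

Lemma derivn_root_exp (a : R) q n k : (k < n)%N ->
  (('X - a%:P) ^+ n * q)^`(k).[a] = 0.
Proof.
elim: k n q => [|k IH] [|n] q // kn.
  by rewrite derivn0 exprS !hornerM hornerXsubC subrr !mul0r.
rewrite derivSn derivM deriv_exp derivXsubC mul1r /=.
rewrite (_ : _ + _ = ('X - a%:P) ^+ n * (q *+ n.+1 + ('X - a%:P) * q^`())).
  exact: IH.
by rewrite mulrDr mulrnAl mulrnAr exprSr !mulrA.
Qed.

(* [t^m (1 - t)^(m+1) / m!] *)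
Definition bump_poly (m : nat) : {poly R} :=
  ((m`!)%:R^-1 : R) *: (('X - 1%:P) ^+ m.+1 * 'X^m) * ((-1) ^+ m.+1)%:P.

Lemma bump_poly_at1 m k : (k <= m)%N -> (bump_poly m)^`(k).[1] = 0.
Proof.
move=> km; rewrite /bump_poly -scalerAl -mulrA derivnZ hornerZ.
by rewrite derivn_root_exp ?mulr0.
Qed.

Lemma bump_poly_at0 m k : (k < m)%N -> (bump_poly m)^`(k).[0] = 0.
Proof.
move=> km; rewrite horner_coef0 coef_derivn addn0 /bump_poly -scalerAl coefZ.
by rewrite coefMC coefMXn km mul0r mulr0 mul0rn.
Qed.

(** This value normalizes the profile: the lower derivatives vanish at 0 and [char_poly] is monic,
    so the profile is 1 there. *)
Lemma bump_poly_top m : (bump_poly m)^`(m).[0] = 1.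
Proof.
rewrite horner_coef0 coef_derivn addn0 /bump_poly -scalerAl coefZ.
rewrite coefMC coefMXn ltnn subnn -horner_coef0 horner_exp hornerXsubC sub0r -exprMn.
by rewrite mulrNN mulr1 expr1n mulr1 ffactnn -[LHS]mulr_natr mulVf //.
Qed.

(** Coefficientwise majorants are stable under sums and products, which is what the expansion of a
    determinant needs. *)
Definition majorized p q := forall i, `|p`_i| <= q`_i.

Lemma majorizedM p p' q q' : majorized p p' -> majorized q q' ->
  majorized (p * q) (p' * q').
Proof.
move=> hp hq i; rewrite !coefM; apply: le_trans (ler_norm_sum _ _ _) _.
by apply: ler_sum => j _; rewrite normrM ler_pM.
Qed.

Lemma majorizedD p p' q q' : majorized p p' -> majorized q q' ->
  majorized (p + q) (p' + q').
Proof.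
move=> hp hq i; rewrite !coefD; apply: le_trans (ler_normD _ _) _.
by rewrite lerD.
Qed.

(** In the Leibniz expansion every entry of ['X - A] is majorized by ['X + al], so the bound depends
    on [al] and [n] only. *)
Lemma char_poly_bounded (n : nat) (al : R) : 0 <= al -> exists X : nat -> R,
  forall A : 'M[R]_n, (forall i j, `|A i j| <= al) ->
  forall k, `|(char_poly A)`_k| <= X k.
Proof.
move=> al0; pose e : {poly R} := 'X + al%:P.
exists (fun k => (\sum_(s : 'S_n) \prod_(i < n) e)`_k) => A Aal.
change (majorized (char_poly A) (\sum_(s : 'S_n) \prod_(i < n) e)).
rewrite /char_poly /determinant.
apply: (big_ind2 majorized) => [i||s _].
- by rewrite coef0 normr0.
- by move=> ? ? ? ?; exact: majorizedD.
have h : majorized (\prod_i char_poly_mx A i (s i)) (\prod_(i < n) e).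
  apply: (big_ind2 majorized) => [i||i _ k].
  - by rewrite coef1; case: (i == 0%N); rewrite ?normr1 ?normr0.
  - by move=> ? ? ? ?; exact: majorizedM.
  rewrite !mxE /e !coefD coefN !coefC coefMn coefX.
  apply: le_trans (ler_normB _ _) _; apply: lerD.
    case: (i == s i); rewrite ?mulr1n ?mulr0n ?normr0 //.
    by rewrite ger0_norm.
  by case: (k == 0%N); rewrite ?normr0.
move=> k; apply: le_trans (h k).
by case: (perm.odd_perm s); rewrite ?expr1 ?expr0 ?mul1r ?mulN1r ?coefN ?normrN.
Qed.

End PolynomialEstimates.

Section CayleyHamilton.
Variables (R : realType) (n : nat).
Notation m := n.+1.

Lemma norm1_mulmx (al : R) (A : 'M[R]_m) (s : 'rV[R]_m) :
  (forall i j, `|A i j| <= al) -> norm1 (s *m A) <= m%:R * al * norm1 s.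
Proof.
move=> Aal; apply: le_trans (_ : \sum_(i < m) al * norm1 s <= _); last first.
  by rewrite sumr_const card_ord -[leLHS]mulr_natl mulrA.
apply: ler_sum => i _; rewrite mxE mulr_sumr.
apply: le_trans (ler_norm_sum _ _ _) _; apply: ler_sum => j _.
by rewrite normrM mulrC ler_wpM2r.
Qed.

Lemma Cayley_Hamilton_row (A : 'M[R]_m) (s : 'rV[R]_m) :
  \sum_(k < m.+1) (char_poly A)`_k *: (s *m A ^+ k) = 0.
Proof.
have := Cayley_Hamilton A; rewrite -{1}[char_poly A]coefK poly_def raddf_sum /=.
rewrite size_char_poly => /(congr1 (mulmx s)); rewrite mulmx0 mulmx_sumr => e; rewrite -[RHS]e.
apply: eq_bigr => k _.
by rewrite linearZ /= rmorphXn /= horner_mx_X scalemxAr.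
Qed.

(** The sum [1 + ka + ... + ka^(k-1)], written as the recursion that the accumulated error
    satisfies. *)
Fixpoint geom (ka : R) (k : nat) : R := if k is k'.+1 then ka * geom ka k' + 1 else 0.

Lemma geom_ge0 ka k : 0 <= ka -> 0 <= geom ka k.
Proof. by move=> ka0; elim: k => //= k IH; rewrite addr_ge0 // mulr_ge0. Qed.

(** Iterating the approximate recursion puts [S k] within [geom (m%:R * al) k * rho] of
    [S 0 *m A ^+ k]; Cayley-Hamilton annihilates the combination of the latter. *)
Lemma Cayley_Hamilton_approx (al rho : R) (A : 'M[R]_m) (S : nat -> 'rV[R]_m) (X : nat -> R) :
  0 <= al -> 0 <= rho ->
  (forall i j, `|A i j| <= al) -> (forall k, `|(char_poly A)`_k| <= X k) ->
  (forall k, (k < m)%N -> norm1 (S k.+1 - S k *m A) <= rho) ->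
  norm1 (\sum_(k < m.+1) (char_poly A)`_k *: S k) <=
  (\sum_(k < m.+1) X k * geom (m%:R * al) k) * rho.
Proof.
move=> al0 rho0 Aal AX SA.
have dS k : (k <= m)%N -> norm1 (S k - S 0%N *m A ^+ k) <= geom (m%:R * al) k * rho.
  elim: k => [|k IH] km; first by rewrite expr0 mulmx1 subrr norm10 mul0r.
  have -> : S k.+1 - S 0%N *m A ^+ k.+1 =
      (S k.+1 - S k *m A) + (S k - S 0%N *m A ^+ k) *m A.
    by rewrite exprSr mulmxBl -mulmxA subrKA.
  apply: le_trans (ler_norm1D _ _) _; rewrite /= mulrDl mul1r addrC.
  apply: lerD (SA _ km); apply: le_trans (norm1_mulmx _ Aal) _.
  by rewrite -[leRHS]mulrA ler_wpM2l ?mulr_ge0 // IH // ltnW.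
rewrite -[X in norm1 X]subr0 -[X in norm1 (_ - X)](Cayley_Hamilton_row A (S 0%N)) -sumrB mulr_suml.
apply: le_trans (ler_norm1_sum _ _ _) _; apply: ler_sum => k _.
rewrite -scalerBr norm1Z -mulrA ler_pM ?norm1_ge0 // dS // -ltnS; exact: ltn_ord.
Qed.

End CayleyHamilton.

(** * Variations along sampled scalar functions *)

Section SampledPolynomials.
Variables (R : realType) (m n2 : nat) (B : 'rV[R]_m -> 'rV[R]_m -> 'rV[R]_n2).
Hypothesis Blin : forall (a : R) x y z, B (a *: x + y) z = a *: B x z + B y z.
Hypothesis Bskew : forall x y, B x y = - B y x.
Variables (N : nat) (N_gt0 : (0 < N)%N).
Implicit Types (a : nat -> 'rV[R]_m) (p : {poly R}).

Definition samp p (j : nat) : R := p.[j%:R / N%:R].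

(** Discrete form of [2 \int f u], where [a j] stands for the integral of [u] over cell [j]. *)
Definition wsum (f : nat -> R) a : 'rV[R]_m := \sum_(j < N) (f j + f j.+1) *: a j.

(** Discrete form of [\int f' u]. *)
Definition dsum (f : nat -> R) a : 'rV[R]_m :=
  N%:R *: \sum_(j < N) (f j.+1 - f j) *: a j.

Let Nr0 : N%:R != 0 :> R. Proof. by rewrite pnatr_eq0 -lt0n. Qed.

Lemma darea_scaled f z a : darea B N (fun j => f j *: z) a = B z (wsum f a).
Proof.
rewrite /darea (bil_sumr Blin Bskew); apply: eq_bigr => j _.
by rewrite -scalerDl (bilZl Blin) (bilZr Blin Bskew).
Qed.

Lemma denergy_scaled f z a : denergy N (fun j => f j *: z) a = dotv z (dsum f a).
Proof.
rewrite /denergy /dsum dotvZr dotv_sumr; congr (_ * _); apply: eq_bigr => j _.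
by rewrite /incr -scalerBl !dotvZr dotvC.
Qed.

Lemma area_scaled (f : nat -> R) z : area B N (fun j => f j *: z) = 0.
Proof.
rewrite /area big1 // => j _.
by rewrite (bilZl Blin) (bilZr Blin Bskew) (bilxx Bskew) !scaler0.
Qed.

Lemma node01 j : (j <= N)%N -> 0 <= (j%:R / N%:R : R) <= 1.
Proof.
by move=> jN; rewrite divr_ge0 //= ler_pdivrMr ?ltr0n // mul1r ler_nat.
Qed.

Lemma nodeB j : j.+1%:R / N%:R - j%:R / N%:R = N%:R^-1 :> R.
Proof. by rewrite -mulrBl -natr1 addrAC subrr add0r mul1r. Qed.

Lemma samp0 p : samp p 0 = p.[0].
Proof. by rewrite /samp mul0r. Qed.

Lemma sampN p : samp p N = p.[1].
Proof. by rewrite /samp divff. Qed.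

Lemma samp_lipschitz L p j : (j < N)%N ->
  (forall x y, 0 <= x <= 1 -> 0 <= y <= 1 -> `|p.[y] - p.[x]| <= L * `|y - x|) ->
  `|samp p j.+1 - samp p j| <= L / N%:R.
Proof.
move=> jN LP; apply: le_trans (LP _ _ (node01 (ltnW jN)) (node01 jN)) _.
by rewrite nodeB ger0_norm // invr_ge0.
Qed.

(** Both sums discretize [2 \int p' u]; their weights differ by [N] times a trapezoid error of order
    [1 / N^2]. *)
Lemma dsum_trapezoid L p a :
  (forall x y, 0 <= x <= 1 -> 0 <= y <= 1 ->
    `|2 * (p.[y] - p.[x]) - (y - x) * (p^`().[x] + p^`().[y])| <= L * (y - x) ^+ 2) ->
  norm1 (2 *: dsum (samp p) a - wsum (samp p^`()) a) <=
  L / N%:R * \sum_(j < N) norm1 (a j).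
Proof.
move=> LP; rewrite /dsum /wsum scalerA scaler_sumr -sumrB mulr_sumr.
apply: le_trans (ler_norm1_sum _ _ _) _; apply: ler_sum => j _.
rewrite scalerA -scalerBl norm1Z ler_wpM2r ?norm1_ge0 //.
have := LP _ _ (node01 (ltnW (ltn_ord j))) (node01 (ltn_ord j)).
rewrite nodeB -!/(samp _ _) => h.
have -> : 2 * N%:R * (samp p j.+1 - samp p j) - (samp p^`() j + samp p^`() j.+1) =
   N%:R * (2 * (samp p j.+1 - samp p j) - N%:R^-1 * (samp p^`() j + samp p^`() j.+1)).
  by field.
rewrite normrM ger0_norm //; apply: le_trans (ler_wpM2l (ler0n _ _) h) _.
by rewrite le_eqVlt; apply/orP; left; apply/eqP; field.
Qed.

(** As [v] starts at 0, each vertex is bounded by the total length [s]; the area is then at most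
    [b * s ^+ 2], and Cauchy-Schwarz bounds [s ^+ 2] by the energy. *)
Lemma area_poincare b (v : nat -> 'rV[R]_m) : 0 <= b ->
  (forall x y, norm1 (B x y) <= b * (enorm x * enorm y)) ->
  v 0%N = 0 -> norm1 (area B N v) <= b * energy N v.
Proof.
move=> b0 bP v0; set s := \sum_(j < N) enorm (incr v j).
have vs (j : 'I_N) : enorm (v j) <= s.
  have -> : v j = \sum_(i < j) incr v i by rewrite sum_increments v0 subr0.
  apply: le_trans (ler_enorm_sum _ _ _) _.
  rewrite (big_ord_widen N (fun i => enorm (incr v i)) (ltnW (ltn_ord j))) /s.
  rewrite [leRHS](bigID (fun i : 'I_N => (i < j)%N)) /= lerDl.
  by apply: sumr_ge0 => i _; exact: enorm_ge0.
apply: le_trans (ler_norm1_sum _ _ _) _.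
apply: le_trans (_ : \sum_(j < N) b * (s * enorm (incr v j)) <= _).
  apply: ler_sum => j _.
  have -> : B (v j) (v j.+1) = B (v j) (incr v j).
    by rewrite /incr (bilDr Blin Bskew) (bilNr Blin Bskew) (bilxx Bskew) subr0.
  by apply: le_trans (bP _ _) _; rewrite ler_wpM2l // ler_wpM2r ?enorm_ge0.
rewrite -!mulr_sumr ler_wpM2l // -/s -expr2.
exact: (sqr_sum_le N (fun j => enorm (incr v j))).
Qed.

End SampledPolynomials.

(** * Near-minimizing polygons *)

Section LinearCombinations.
Variables (R : realType) (m n2 : nat) (B : 'rV[R]_m -> 'rV[R]_m -> 'rV[R]_n2).
Hypothesis Blin : forall (a : R) x y z, B (a *: x + y) z = a *: B x z + B y z.
Variables (N : nat) (T : finType) (z : T -> R) (a : nat -> 'rV[R]_m).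

Lemma darea_comb (u : T -> nat -> 'rV[R]_m) :
  darea B N (fun j => \sum_t z t *: u t j) a = \sum_t z t *: darea B N (u t) a.
Proof.
rewrite /darea; under [RHS]eq_bigr do rewrite scaler_sumr.
rewrite [RHS]exchange_big /=; apply: eq_bigr => j _.
rewrite -big_split (bil_suml Blin) /=; apply: eq_bigr => t _.
by rewrite -scalerDr (bilZl Blin).
Qed.

Lemma denergy_comb (u : T -> nat -> 'rV[R]_m) :
  denergy N (fun j => \sum_t z t *: u t j) a = \sum_t z t * denergy N (u t) a.
Proof.
rewrite /denergy; under [RHS]eq_bigr do rewrite mulrCA.
rewrite -[RHS]mulr_sumr; congr (_ * _); under [RHS]eq_bigr do rewrite mulr_sumr.
rewrite [RHS]exchange_big /=; apply: eq_bigr => j _.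
rewrite {1}/incr -sumrB dotv_sumr; apply: eq_bigr => t _.
by rewrite -scalerBr dotvZr.
Qed.

Lemma wsum_comb (f : T -> nat -> R) :
  wsum N (fun j => \sum_t z t * f t j) a = \sum_t z t *: wsum N (f t) a.
Proof.
rewrite /wsum; under [RHS]eq_bigr do rewrite scaler_sumr.
rewrite [RHS]exchange_big /=; apply: eq_bigr => j _.
rewrite -big_split scaler_suml; apply: eq_bigr => t _.
by rewrite scalerA mulrDr.
Qed.

End LinearCombinations.

Section Profile.
Variables (R : realType) (n n2 : nat).
Notation m := n.+1.
Variable B : 'rV[R]_m -> 'rV[R]_m -> 'rV[R]_n2.
Hypothesis Blin : forall (a : R) x y z, B (a *: x + y) z = a *: B x z + B y z.
Hypothesis Bskew : forall x y, B x y = - B y x.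

(** Sampled increments are at most [L / N], and Cauchy-Schwarz over the index pairs makes the bound
    quadratic in [z] and uniform in [N]. *)
Lemma energy_test (N : nat) (L : R) (p : nat -> {poly R}) (z : 'I_m * 'I_m -> R) :
  (0 < N)%N -> 0 <= L ->
  (forall k x y, (k < m)%N -> 0 <= x <= 1 -> 0 <= y <= 1 ->
     `|(p k).[y] - (p k).[x]| <= L * `|y - x|) ->
  energy N (fun j => \sum_t z t *: (samp N (p t.1) j *: delta_mx 0 t.2)) <=
  #|{: 'I_m * 'I_m}|%:R * L ^+ 2 * \sum_t z t ^+ 2.
Proof.
move=> N0 L0 LP; have Nr0 : 0 < N%:R :> R by rewrite ltr0n.
set s := \sum_t z t ^+ 2.
have s0 : 0 <= s by apply: sumr_ge0 => t _; exact: sqr_ge0.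
apply: le_trans (_ : N%:R * \sum_(j < N) (#|{: 'I_m * 'I_m}|%:R * s * (L / N%:R) ^+ 2) <= _).
  rewrite ler_wpM2l //; apply: ler_sum => j _.
  rewrite -sumrB.
  have le1 : enorm (\sum_(t : 'I_m * 'I_m) (z t *: (samp N (p t.1) j.+1 *: delta_mx 0 t.2) -
      z t *: (samp N (p t.1) j *: delta_mx 0 t.2))) <= (\sum_t `|z t|) * (L / N%:R).
    apply: le_trans (ler_enorm_sum _ _ _) _; rewrite mulr_suml; apply: ler_sum => t _.
    rewrite -scalerBr -scalerBl !enormZ enorm_delta mulr1 ler_wpM2l //.
    by apply: (samp_lipschitz N0 (ltn_ord j)) => x y; apply: LP; exact: ltn_ord.
  apply: le_trans (_ : ((\sum_t `|z t|) * (L / N%:R)) ^+ 2 <= _).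
    rewrite ler_sqr ?nnegrE ?enorm_ge0 // mulr_ge0 ?divr_ge0 //.
    exact: sumr_ge0.
  rewrite exprMn ler_wpM2r ?sqr_ge0 //.
  apply: le_trans (sqr_sum_le_fin _) _; rewrite ler_wpM2l //.
  by rewrite le_eqVlt /s; apply/orP; left; apply/eqP; apply: eq_bigr => t _;
    rewrite real_normK ?num_real.
rewrite sumr_const card_ord -[X in _ * X]mulr_natl le_eqVlt; apply/orP; left; apply/eqP.
by field; rewrite gt_eqF.
Qed.

Hypothesis Bspan : forall v : 'rV[R]_n2,
  exists k (c : 'I_k -> R) (x y : 'I_k -> 'rV[R]_m),
    v = \sum_(i < k) c i *: B (x i) (y i).
Hypothesis n2_gt0 : (0 < n2)%N.

Notation D2 p := (ccdist B p (0, 0) ^+ 2).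

(* First-order optimality of a near-minimizing polygon makes its increments
   solve, weakly and approximately, the linear equation [u' = u A] with a bounded
   matrix [A]; the profile is the polynomial [\sum_k (char_poly A)`_k psi^`(k)]
   with [psi := bump_poly R m], for which [\int phi u] is nearly [0]. *)
Lemma near_minimizer_profile :
  exists (K : nat) (C Phi Gam L : R),
  [/\ [/\ (0 < K)%N, 0 <= C, 0 <= Phi, 0 <= Gam & 0 <= L],
    forall M, (0 < M)%N -> forall (p : pt R m n2) x, x 0%N = p.1 -> x (K * M)%N = 0 ->
      (ccdistE B p (0%R, 0%R) < +oo)%E /\
      D2 p <= energy (K * M)%N x + C * norm1 (p.2 + area B (K * M)%N x) &
    forall M, (0 < M)%N -> forall (p : pt R m n2) x (tau : R), 0 < tau ->
      x 0%N = p.1 -> x (K * M)%N = 0 ->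
      energy (K * M)%N x <= D2 p + tau ^+ 2 ->
      C * norm1 (p.2 + area B (K * M)%N x) <= tau ^+ 2 ->
      L / (K * M)%:R * \sum_(j < (K * M)%N) norm1 (incr x j) <= tau ->
      exists f : nat -> R,
      [/\ f 0%N = 1, f (K * M)%N = 0,
          (K * M)%:R * \sum_(j < (K * M)%N) (f j.+1 - f j) ^+ 2 <= Phi &
          norm1 (wsum (K * M)%N f (incr x)) <= Gam * tau]].
Proof.
have [K [C [K0 C0 HC]]] := sqr_ccdist_le_area Blin Bskew Bspan n2_gt0.
have [b b0 bP] := bil_bounded Blin Bskew.
pose psi k : {poly R} := (bump_poly R m)^`(k).
have /choice[Lp LpP] : forall k, exists l : R, 0 <= l /\
    forall x y, 0 <= x <= 1 -> 0 <= y <= 1 -> `|(psi k).[y] - (psi k).[x]| <= l * `|y - x|.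
  by move=> k; have [l l0 lP] := poly_lipschitz (psi k); exists l.
have /choice[Lt LtP] : forall k, exists l : R, 0 <= l /\
    forall x y, 0 <= x <= 1 -> 0 <= y <= 1 ->
    `|2 * ((psi k).[y] - (psi k).[x]) - (y - x) * ((psi k)^`().[x] + (psi k)^`().[y])|
      <= l * (y - x) ^+ 2.
  by move=> k; have [l l0 lP] := poly_trapezoid (psi k); exists l.
have Lp0 k : 0 <= Lp k by case: (LpP k).
have Lt0 k : 0 <= Lt k by case: (LtP k).
pose L1 := \sum_(k < m) Lp k.
have L10 : 0 <= L1 by apply: sumr_ge0.
pose L := \sum_(k < m) Lt k.
have L0 : 0 <= L by apply: sumr_ge0.
pose C1 : R := (1 + C * b) * (#|{: 'I_m * 'I_m}|%:R * L1 ^+ 2).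
have C10 : 0 <= C1 by rewrite mulr_ge0 ?addr_ge0 ?mulr_ge0 // sqr_ge0.
(* The added 1 ensures the strict positivity required by [lagrange_multiplier]. *)
pose C2 := C1 + 1.
have C20 : 0 < C2 by rewrite /C2; lra.
pose C3 := 2 * C2 + (C * n2%:R) ^+ 2.
have C31 : 0 <= C3 + 1.
  by rewrite addr_ge0 // /C3 addr_ge0 ?sqr_ge0 // mulr_ge0 // ltW.
have C30 : 0 <= C3 by rewrite addr_ge0 ?sqr_ge0 // mulr_ge0 // ltW.
pose al := 2 * ((C3 + 1) * b).
have al0 : 0 <= al by rewrite !mulr_ge0 // addr_ge0.
have [X XP] := char_poly_bounded m al0.
have X0 k : 0 <= X k.
  apply: le_trans (XP 0 _ k); first exact: normr_ge0.
  by move=> i j; rewrite mxE normr0.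
pose G0 := \sum_(k < m.+1) X k * geom (m%:R * al) k.
have G00 : 0 <= G0.
  by apply: sumr_ge0 => k _; rewrite mulr_ge0 // geom_ge0 // mulr_ge0.
pose rho1 : R := 2 * (m%:R * (C3 + 1)) + 1.
have rho10 : 0 <= rho1 by rewrite addr_ge0 // !mulr_ge0 // addr_ge0.
pose Phi := (\sum_(k < m.+1) X k * Lp k) ^+ 2.
exists K, C, Phi, (G0 * rho1), L; split=> //.
  by split=> //; [exact: sqr_ge0 | exact: mulr_ge0].
move=> M M0 p x tau tau0 x0 xN xE xA xL.
set N := (K * M)%N in xN xE xA xL *.
have N0 : (0 < N)%N by rewrite muln_gt0 K0.
have Nr0 : 0 < N%:R :> R by rewrite ltr0n.
(* Comparison of [x] with [x + v]: one [tau ^+ 2] pays for the energy excess of [x], the other for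
   its area defect, and [C * b] for the area of [v]. *)
have nearmin (v : nat -> 'rV[R]_m) : v 0%N = 0 -> v N = 0 ->
    0 <= 2 * tau ^+ 2 + 2 * denergy N v (incr x) + C * norm1 (darea B N v (incr x)) +
         (1 + C * b) * energy N v.
  move=> v0 vN.
  have y0 : x 0%N + v 0%N = p.1 by rewrite v0 addr0.
  have yN : x N + v N = 0 by rewrite vN addr0.
  have [_] := HC M M0 p (fun j => x j + v j) y0 yN.
  rewrite -/N energyD (areaD Blin Bskew) v0 vN !(bil0l Blin) subrr addr0 !addrA => h.
  have h1 : norm1 (p.2 + area B N x + darea B N v (incr x) + area B N v) <=
      norm1 (p.2 + area B N x) + norm1 (darea B N v (incr x)) + norm1 (area B N v).
    apply: le_trans (ler_norm1D _ _) _; rewrite lerD2r; exact: ler_norm1D.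
  have h2 := area_poincare Blin Bskew N b0 bP v0.
  have h3 := ler_wpM2l C0 h1; have h4 := ler_wpM2l C0 h2.
  lra.
(* Test variations [psi^(k) e_i]; the restriction [k < m] makes them vanish at both ends. *)
pose u (t : 'I_m * 'I_m) (j : nat) : 'rV[R]_m := samp N (psi t.1) j *: delta_mx 0 t.2.
have [|la [la2 res]] := @lagrange_multiplier R n2 _ (fun t => denergy N (u t) (incr x))
    (fun t => darea B N (u t) (incr x)) (tau ^+ 2) C C2 (exprn_gt0 2 tau0) C0 C20.
  move=> z.
  pose v j := \sum_t z t *: u t j.
  have v0 : v 0%N = 0.
    by rewrite /v big1 // => t _; rewrite /u samp0 bump_poly_at0 ?scale0r ?scaler0 //.
  have vN : v N = 0.
    rewrite /v big1 // => t _; rewrite /u sampN // bump_poly_at1 ?scale0r ?scaler0 //.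
    exact: ltnW (ltn_ord _).
  have := nearmin v v0 vN.
  rewrite (denergy_comb N z (incr x) u) (darea_comb Blin N z (incr x) u) => h.
  apply: le_trans h _; rewrite lerD2l.
  have le_v : energy N v <= #|{: 'I_m * 'I_m}|%:R * L1 ^+ 2 * \sum_t z t ^+ 2.
    apply: energy_test => // k y y' km y01 y'01.
    have [_ h] := LpP k; apply: le_trans (h _ _ y01 y'01) _; rewrite ler_wpM2r //.
    by rewrite /L1 (bigD1 (Ordinal km)) //= lerDl sumr_ge0.
  have Cb0 : 0 <= 1 + C * b by rewrite addr_ge0 // mulr_ge0.
  apply: le_trans (ler_wpM2l Cb0 le_v) _; rewrite mulrA -/C1 /C2 ler_wpM2r //.
    by apply: sumr_ge0 => t _; exact: sqr_ge0.
  by rewrite lerDl.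
have laN : enorm la <= C3 + 1.
  rewrite -/C3 in la2; have := sqr_ge0 (enorm la - 1); have := enorm_ge0 la; nra.
pose S k := wsum N (samp N (psi k)) (incr x).
pose Q k := dsum N (samp N (psi k)) (incr x).
(* Chosen so that the multiplier rule, tested on all coordinate directions, reads [2 Q_k = S_k A] up
   to an error of order [tau]. *)
pose A : 'M[R]_m := \matrix_(l, i) (2 * dotv la (B (delta_mx 0 i) (delta_mx 0 l))).
have Aal i j : `|A i j| <= al.
  rewrite mxE normrM ger0_norm // /al ler_wpM2l //.
  apply: le_trans (ler_norm_dotv _ _) _; rewrite ler_pM ?enorm_ge0 //.
  apply: le_trans (ler_enorm_norm1 _) _; apply: le_trans (bP _ _) _.
  by rewrite !enorm_delta !mulr1.
have SA (s : 'rV[R]_m) i : (s *m A) 0 i = 2 * dotv la (B (delta_mx 0 i) s).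
  rewrite mxE {2}(row_sum_delta s) (bil_sumr Blin Bskew) dotv_sumr mulr_sumr.
  apply: eq_bigr => l _; rewrite mxE (bilZr Blin Bskew) dotvZr; ring.
have resi (k i : 'I_m) : `|Q k 0 i - dotv la (B (delta_mx 0 i) (S k))| <= (C3 + 1) * tau.
  have : (denergy N (u (k, i)) (incr x) - dotv la (darea B N (u (k, i)) (incr x))) ^+ 2 <=
      tau ^+ 2 * C3.
    apply: le_trans res; rewrite (bigD1 (k, i)) //= lerDl.
    by apply: sumr_ge0 => t _; exact: sqr_ge0.
  rewrite /u denergy_scaled (darea_scaled Blin Bskew) dotv_delta -/(S k) -/(Q k) => h.
  rewrite -ler_sqr ?nnegrE ?normr_ge0 ?mulr_ge0 ?(ltW tau0) //.
  rewrite real_normK ?num_real //; apply: le_trans h _; rewrite exprMn mulrC.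
  rewrite ler_wpM2r ?sqr_ge0 //; nra.
(* The trapezoid rule replaces [2 Q_k] by [S_(k+1)], which closes the recursion. *)
have Srec : forall k, (k < m)%N -> norm1 (S k.+1 - S k *m A) <= rho1 * tau.
  move=> k km; have [_ trap] := LtP k.
  have h1 := dsum_trapezoid N0 (incr x) trap.
  have h2 : norm1 (2 *: Q k - S k *m A) <= 2 * (m%:R * (C3 + 1)) * tau.
    apply: le_trans (_ : \sum_(i < m) 2 * ((C3 + 1) * tau) <= _); last first.
      rewrite sumr_const card_ord -[leLHS]mulr_natl.
      by rewrite le_eqVlt; apply/orP; left; apply/eqP; ring.
    apply: ler_sum => i _; rewrite mxE [X in _ + X]mxE SA mxE -mulrBr normrM.
    by rewrite ger0_norm // ler_wpM2l // (resi (Ordinal km)).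
  have -> : S k.+1 - S k *m A = (2 *: Q k - S k *m A) - (2 *: Q k - S k.+1).
    by rewrite opprB [RHS]addrC subrKA.
  apply: le_trans (ler_norm1D _ _) _; rewrite norm1N /rho1 mulrDl mul1r.
  apply: lerD h2 _; apply: le_trans h1 _; apply: le_trans xL.
  rewrite ler_wpM2r ?sumr_ge0 // => [j _|]; first exact: norm1_ge0.
  rewrite ler_wpM2r ?invr_ge0 // /L (bigD1 (Ordinal km)) //= lerDl.
  by apply: sumr_ge0.
pose chi := char_poly A.
have chiX k : `|chi`_k| <= X k by apply: XP.
(* The sum includes [k = m], the only term not vanishing at 0. *)
pose f (j : nat) : R := \sum_(k < m.+1) chi`_k * samp N (psi k) j.
have chi_m : chi`_m = 1.
  have := char_poly_monic A; rewrite monicE lead_coefE size_char_poly => /eqP; exact.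
exists f; split.
- rewrite /f big_ord_recr /= big1 => [|k _].
    by rewrite chi_m samp0 add0r mul1r; exact: (bump_poly_top R m).
  by rewrite samp0 bump_poly_at0 ?mulr0.
- rewrite /f big1 // => k _; rewrite sampN // bump_poly_at1 ?mulr0 //.
  by rewrite -ltnS; exact: ltn_ord.
- apply: le_trans (_ : N%:R * \sum_(j < N) (Phi / N%:R ^+ 2) <= _); last first.
    rewrite sumr_const card_ord -[X in _ * X]mulr_natl le_eqVlt; apply/orP; left; apply/eqP.
    by field; rewrite gt_eqF.
  rewrite ler_wpM2l //; apply: ler_sum => j _; rewrite /Phi -expr_div_n.
  rewrite -(real_normK (num_real (f j.+1 - f j))) ler_sqr ?nnegrE //; last first.
    by rewrite divr_ge0 // sumr_ge0 // => k _; rewrite mulr_ge0.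
  rewrite /f -sumrB mulr_suml; apply: le_trans (ler_norm_sum _ _ _) _.
  apply: ler_sum => k _; rewrite -mulrBr normrM -mulrA ler_pM //.
  by have [_ lip] := LpP k; exact: (samp_lipschitz N0 (ltn_ord j)).
- rewrite /f (wsum_comb N (fun k : 'I_m.+1 => chi`_k) (incr x) (fun k => samp N (psi k))).
  rewrite -[leRHS]mulrA; apply: (@Cayley_Hamilton_approx R n al (rho1 * tau) A S X) => //.
  by rewrite mulr_ge0 // ltW.
Qed.

End Profile.

(** * Distance at the shifted points and h-semiconcavity *)

Lemma enormG_horizontal (R : realType) (m n2 : nat) (h : 'rV[R]_m) :
  enormG ((h, 0) : pt R m n2) = enorm h.
Proof.
rewrite /enormG /= [X in _ + X]big1 ?addr0 // => j _.
by rewrite mxE expr0n.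
Qed.

Section ShiftedDistance.
Variables (R : realType) (m n2 : nat) (B : 'rV[R]_m -> 'rV[R]_m -> 'rV[R]_n2).
Hypothesis Blin : forall (a : R) x y z, B (a *: x + y) z = a *: B x z + B y z.
Hypothesis Bskew : forall x y, B x y = - B y x.
Variables (N : nat) (C b Phi : R).
Hypotheses (C0 : 0 <= C) (b0 : 0 <= b).
Hypothesis bP : forall x y, norm1 (B x y) <= b * (enorm x * enorm y).
Hypothesis le_area : forall (p : pt R m n2) x, x 0%N = p.1 -> x N = 0 ->
  ccdist B p (0, 0) ^+ 2 <= energy N x + C * norm1 (p.2 + area B N x).
Variables (p : pt R m n2) (x : nat -> 'rV[R]_m) (f : nat -> R).
Hypotheses (x0 : x 0%N = p.1) (xN : x N = 0) (f0 : f 0%N = 1) (fN : f N = 0).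
Hypothesis fE : N%:R * \sum_(j < N) (f j.+1 - f j) ^+ 2 <= Phi.

(* The boundary term of [areaD] cancels the twist [B p.1 h] of the group law. *)
Lemma shifted_distance h : ccdist B (gmul B p (h, 0)) (0, 0) ^+ 2 <=
  energy N x + 2 * dotv h (dsum N f (incr x)) + Phi * enorm h ^+ 2 +
  C * (norm1 (p.2 + area B N x) + b * (enorm h * norm1 (wsum N f (incr x)))).
Proof.
pose w j := f j *: h.
have w0 : w 0%N = h by rewrite /w f0 scale1r.
have wN : w N = 0 by rewrite /w fN scale0r.
have y0 : x 0%N + w 0%N = (gmul B p (h, 0)).1 by rewrite w0 x0.
have yN : x N + w N = 0 by rewrite xN wN addr0.
apply: le_trans (le_area (x := fun j => x j + w j) y0 yN) _.
apply: lerD.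
  rewrite energyD denergy_scaled lerD2l; apply: le_trans (_ : energy N w <= _) => //.
  rewrite /energy (eq_bigr (fun j : 'I_N => (f j.+1 - f j) ^+ 2 * enorm h ^+ 2)) => [|j _].
    by rewrite -mulr_suml mulrA ler_wpM2r ?sqr_ge0.
  by rewrite /w -scalerBl enormZ exprMn real_normK ?num_real.
apply: ler_wpM2l => //; rewrite (areaD Blin Bskew) (area_scaled Blin Bskew).
rewrite (darea_scaled Blin Bskew) w0 wN (bil0l Blin) subr0 x0 /=.
have -> : p.2 + 0 + B p.1 h + (area B N x + B h (wsum N f (incr x)) + 0 + B h p.1) =
    (p.2 + area B N x) + B h (wsum N f (incr x)).
  by rewrite (Bskew h p.1); apply/rowP => k; rewrite !mxE; ring.
apply: le_trans (ler_norm1D _ _) _; rewrite lerD2l.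
apply: le_trans (bP _ _) _; rewrite ler_wpM2l // ler_wpM2l ?enorm_ge0 //.
exact: ler_enorm_norm1.
Qed.

End ShiftedDistance.

Unset Implicit Arguments. Set Strict Implicit. Set Printing Implicit Defensive.

Theorem theorem1p1 (R : realType) (m n2 : nat)
    (B : 'rV[R]_m -> 'rV[R]_m -> 'rV[R]_n2) :
  step2_carnot_form B ->
  exists C : R, 0 <= C /\
    forall (p : pt R m n2) (h1 : 'rV[R]_m),
      let h : pt R m n2 := (h1, 0) in
      let d0 := fun q : pt R m n2 => ccdist B q (0, 0) in
      d0 (gmul B p h) ^+ 2 + d0 (gmul B p (ginv h)) ^+ 2 - 2 * d0 p ^+ 2
        <= C * enormG h ^+ 2.
Proof.
case: m B => [|n] B [Blin Bskew Bspan n2_gt0].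
  (* For [m = 0] the form [B] is zero and cannot span a nonzero space. *)
  have [k [c [x [y]]]] := Bspan (const_mx 1).
  rewrite big1 => [/rowP/(_ (Ordinal n2_gt0))|i _].
    by rewrite !mxE => /eqP; rewrite oner_eq0.
  by rewrite (thinmx0 (x i)) (bil0l Blin) scaler0.
have [K [C [Phi [Gam [L [[K0 C0 Phi0 Gam0 L0] le_area profile]]]]]] :=
  near_minimizer_profile Blin Bskew Bspan n2_gt0.
have [b b0 bP] := bil_bounded Blin Bskew.
(* Each of the two shifts costs [Phi * enorm h1 ^+ 2]; every other surviving term tends to 0 with
   [tau]. *)
exists (2 * Phi); split; first by rewrite mulr_ge0.
move=> p h1; cbv zeta; rewrite enormG_horizontal; set hN := enorm h1.
have hN0 : 0 <= hN := enorm_ge0 h1.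
apply/ler_addgt0Pr => e e0.
(* The two shifts together carry an error of two energy excesses and two area defects, each at most
   [tau ^+ 2 <= tau], and two [wsum] terms. *)
pose kap := 4 + 2 * (C * (b * (hN * Gam))).
have CbG : 0 <= C * (b * (hN * Gam)) by rewrite !mulr_ge0.
have kap0 : 0 < kap by rewrite /kap; lra.
pose tau := Num.min 1 (e / kap).
have tau0 : 0 < tau by rewrite lt_min ltr01 divr_gt0.
have tau1 : tau <= 1 by rewrite ge_min lexx.
have tau_e : tau * kap <= e by rewrite -ler_pdivlMr // ge_min lexx orbT.
have tau2 : 0 < tau ^+ 2 by rewrite exprn_gt0.
(* A crude polygon suffices: jump from [p.1] to 0 along the first edge and stay there. *)
have finE : (ccdistE B p (0%R, 0%R) < +oo)%E.
  have [|//] := le_area 1%N isT p (fun j => if j is 0%N then p.1 else 0) erefl.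
  by rewrite muln1; case: (K) K0.
have [K' K'0 approx] := ccdist_polygon_approx Blin Bskew finE tau2.
set D := ccdist B p (0, 0) in approx.
(* Above [q1] the area defect costs at most [tau ^+ 2]; above [q2] the trapezoid error is at most
   [tau]. *)
pose q1 := C * K' / tau ^+ 2.
pose q2 := L * (n.+1%:R * (D ^+ 2 + 3)) / tau.
have q10 : 0 <= q1 by rewrite divr_ge0 ?mulr_ge0 // ltW.
have q20 : 0 <= q2.
  by rewrite divr_ge0 ?(ltW tau0) // !mulr_ge0 // addr_ge0 // sqr_ge0.
have [M M0 qM] : exists2 M, (0 < M)%N & q1 + q2 <= M%:R.
  exists (Num.bound (q1 + q2)).+1 => //.
  apply: ltW; apply: lt_trans (archi_boundP (addr_ge0 q10 q20)) _.
  by rewrite ltr_nat.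
set N := (K * M)%N in le_area profile.
have N0 : (0 < N)%N by rewrite muln_gt0 K0.
have Nr0 : 0 < N%:R :> R by rewrite ltr0n.
have qN : q1 + q2 <= N%:R.
  by apply: le_trans qM _; rewrite ler_nat leq_pmull.
have [x [x0 xN xE xA]] := approx N N0.
have xA2 : C * norm1 (p.2 + area B N x) <= tau ^+ 2.
  apply: le_trans (ler_wpM2l C0 xA) _; rewrite mulrA ler_pdivrMr // [leRHS]mulrC.
  by rewrite -ler_pdivrMr //; apply: le_trans qN; rewrite lerDl.
have sumL : L / N%:R * \sum_(j < N) norm1 (incr x j) <= tau.
  set s := \sum_(j < N) enorm (incr x j).
  have s0 : 0 <= s by apply: sumr_ge0 => j _; exact: enorm_ge0.
  have s2 : s ^+ 2 <= D ^+ 2 + 1.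
    apply: le_trans (sqr_sum_le N (fun j => enorm (incr x j))) _.
    by apply: le_trans xE _; rewrite lerD2l expr_le1 // ltW.
  have sn : \sum_(j < N) norm1 (incr x j) <= n.+1%:R * (D ^+ 2 + 3).
    apply: le_trans (_ : n.+1%:R * s <= _).
      by rewrite mulr_sumr; apply: ler_sum => j _; exact: ler_norm1_enorm.
    rewrite ler_wpM2l //; nra.
  rewrite mulrAC ler_pdivrMr // [leRHS]mulrC -ler_pdivrMr //.
  apply: le_trans (_ : q2 <= _); last by apply: le_trans qN; rewrite lerDr.
  by rewrite ler_wpM2r ?invr_ge0 ?(ltW tau0) // ler_wpM2l.
have [f [f0 fN fE fW]] := profile M M0 p x tau tau0 x0 xN xE xA2 sumL.
have leN (p' : pt R n.+1 n2) y (y0 : y 0%N = p'.1) (yN : y N = 0) :=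
  (le_area M M0 p' y y0 yN).2.
have shift := shifted_distance Blin Bskew C0 b0 bP leN x0 xN f0 fN fE.
(* The same polygon and profile serve both signs, so the terms in [dsum] are opposite and cancel in
   the sum. *)
have h_pos := shift h1; have h_neg := shift (- h1).
rewrite /ginv /= oppr0 -/D.
rewrite enormN dotvNl in h_neg; rewrite -/hN in h_pos h_neg.
have W : C * (b * (hN * norm1 (wsum N f (incr x)))) <= C * (b * (hN * Gam)) * tau.
  rewrite -!mulrA ler_wpM2l // ler_wpM2l // ler_wpM2l //.
move: h_pos h_neg; rewrite !mulrDr => h_pos h_neg.
have tt : tau ^+ 2 <= tau by rewrite expr2 ler_piMl // ltW.
rewrite /kap mulrDr in tau_e.
lra.
Qed.
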